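(* For $k\in\mathbb{N}_0$ let \[ \alpha_q(k)=q^{-4k}[8k+1]^2[8k+1]_{q^2}\frac{(q^2;q^8)_k^2\,(xq^2;q^8)_k\,(q^2/x;q^8)_k}{(q^8;q^8)_k^2\,(xq^8;q^8)_k\,(q^8/x;q^8)_k}, \] \[ s_q(k)=\sum_{j=0}^k\alpha_q(j)\alpha_q(k-j),\qquad t_q(k)=\sum_{j=0}^k\sum_{i=0}^{k-j}\alpha_q(j)\alpha_q(i)\alpha_q(k-j-i), \] \[ u_q(k)=\sum_{j=0}^k\sum_{i=0}^{k-j}\sum_{h=0}^{k-j-i}\alpha_q(j)\alpha_q(i)\alpha_q(h)\alpha_q(k-j-i-h). \] Let $E=1-\dfrac{(1-xq^2)(1-q^2/x)}{(1-q)^2(1+q^2)}$. Then for every positive integer $n$ all of whose prime factors are congruent to $1$ modulo $4$, modulo $[n]_{q^2}(1-xq^{2n})(x-q^{2n})$ we have \[ \sum_{k=0}^{n-1}s_q(k)\equiv[n]_{q^2}^2\frac{(q^4;q^8)_{(n-1)/4}^2}{(q^8;q^8)_{(n-1)/4}^2}q^{1-n}E^2,\qquad \sum_{k=0}^{n-1}t_q(k)\equiv[n]_{q^2}^3\frac{(q^4;q^8)_{(n-1)/4}^3}{(q^8;q^8)_{(n-1)/4}^3}q^{3(1-n)/2}E^3, \] \[ \sum_{k=0}^{n-1}u_q(k)\equiv[n]_{q^2}^4\frac{(q^4;q^8)_{(n-1)/4}^4}{(q^8;q^8)_{(n-1)/4}^4}q^{2(1-n)}E^4. \]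
   Context: $x$ is an indeterminate and $q$ a variable. $(a;q)_0=1$, $(a;q)_k=\prod_{j=0}^{k-1}(1-aq^j)$; $[m]=[m]_q=(1-q^m)/(1-q)$ and $[m]_{q^2}=(1-q^{2m})/(1-q^2)$. For rational functions $A,B$ and a polynomial $P$, $A\equiv B\pmod P$ means that, writing $A-B=A_1/A_2$ in lowest terms, $P$ divides $A_1$ and $\gcd(P,A_2)=1$. *)

(* Defs.v *)
From mathcomp Require Import all_boot all_order all_algebra.

Set Implicit Arguments.
Unset Strict Implicit.
Unset Printing Implicit Defensive.

Import GRing.Theory.
Local Open Scope ring_scope.

(* Q[q][x]: the coefficients of the outer polynomials are polynomials in q. *)
Notation bipoly := {poly {poly rat}}.
Notation ratfun := {fraction bipoly}.

Definition qv : ratfun := tofrac ('X%:P : bipoly).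
Definition xv : ratfun := tofrac ('X : bipoly).

Section Divisibility.
Variable R : comUnitRingType.

(* Divisibility in the ring itself.  The [%|] of polydiv is pseudo-divisibility:
   on {poly {poly rat}} it ignores factors that only involve q. *)
Definition rdivides (a b : R) : Prop := exists c, b = a * c.

Definition rcoprime (a b : R) : Prop :=
  forall d, rdivides d a -> rdivides d b -> d \is a GRing.unit.

End Divisibility.

(* A = B modulo M; the modulus is written as a rational function M so that
   [n]_{q^2} can be given by its usual quotient, but it has to be the image of
   a polynomial P. *)
Definition ratcongr (A B M : ratfun) : Prop :=
  exists P A1 A2 : bipoly,
    [/\ M = tofrac P,
        A2 != 0 /\ A - B = tofrac A1 / tofrac A2,
        rcoprime A1 A2,
        rdivides P A1
      & rcoprime P A2].

Section QSeries.
Variable F : fieldType.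

Definition qpoch (a z : F) (k : nat) : F := \prod_(j < k) (1 - a * z ^+ j).

Definition qint (z : F) (m : nat) : F := (1 - z ^+ m) / (1 - z).

Variables q x : F.

Definition alphaq (k : nat) : F :=
  q ^- (4 * k) * qint q (8 * k + 1) ^+ 2 * qint (q ^+ 2) (8 * k + 1)
  * ((qpoch (q ^+ 2) (q ^+ 8) k ^+ 2 * qpoch (x * q ^+ 2) (q ^+ 8) k
      * qpoch (q ^+ 2 / x) (q ^+ 8) k)
     / (qpoch (q ^+ 8) (q ^+ 8) k ^+ 2 * qpoch (x * q ^+ 8) (q ^+ 8) k
        * qpoch (q ^+ 8 / x) (q ^+ 8) k)).

Definition sq (k : nat) : F :=
  \sum_(j < k.+1) alphaq j * alphaq (k - j).

Definition tq (k : nat) : F :=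
  \sum_(j < k.+1) \sum_(i < (k - j).+1)
    alphaq j * alphaq i * alphaq (k - j - i).

Definition uq (k : nat) : F :=
  \sum_(j < k.+1) \sum_(i < (k - j).+1) \sum_(h < (k - j - i).+1)
    alphaq j * alphaq i * alphaq h * alphaq (k - j - i - h).

Definition Efac : F :=
  1 - (1 - x * q ^+ 2) * (1 - q ^+ 2 / x) / ((1 - q) ^+ 2 * (1 + q ^+ 2)).

End QSeries.

(* Main.v *)
Require Import Defs.
From mathcomp Require Import all_boot all_order all_algebra all_field.
From mathcomp Require Import ring zify.
From Stdlib Require Classical_Prop.

(** The difference of the two sides is a ratio A1 / A2 of coprime elements of
    Q[q][x], and the modulus divides A1 and is coprime to A2 as soon as the
    difference specializes to 0 at the zeros of the modulus: at x = q^(2n), at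
    x = q^(-2n), and at every q = zeta with [n]_{zeta^2} = 0 (x staying
    generic), because the kernel of each of these specializations is principal.

    At x = q^(2n) or q^(-2n) the terms alpha(k) vanish for k > m = (n-1)/4, so
    no truncation occurs in the convolutions (4m < n) and the sums are powers
    of the sum of the alpha(k).  That sum is a terminating very-well-poised
    series in base Q = q^8 with a = q^2; writing
    (1 - qQ^k)^2 = (1 - eQ^k)(1 - aQ^k/e) + (e - q)^2 Q^k / e
    splits it into two summable 6phi5 series.

    At zeta, let d be the order of zeta^2.  Then alpha(ld + k) = c_l alpha(k)
    for k < d, with alpha(k) = 0 for d <= 4k, so the sums factor through a power
    of the sum of the alpha(k) over one period, which is 0 because
    alpha((d-1)/4 - k) = - alpha(k). *)

Set Implicit Arguments.
Unset Strict Implicit.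
Unset Printing Implicit Defensive.

Import GRing.Theory.
Local Open Scope ring_scope.

(** * Truncated convolution powers *)

Section Convolution.
Variable R : comNzRingType.
Implicit Types a b c : nat -> R.

Definition conv2 a (k : nat) : R := \sum_(j < k.+1) a j * a (k - j)%N.

Definition conv3 a (k : nat) : R :=
  \sum_(j < k.+1) \sum_(i < (k - j).+1) a j * a i * a (k - j - i)%N.

Definition conv4 a (k : nat) : R :=
  \sum_(j < k.+1) \sum_(i < (k - j).+1) \sum_(h < (k - j - i).+1)
    a j * a i * a h * a (k - j - i - h)%N.

Lemma coef_polyM n a (p : {poly R}) k : (k < n)%N ->
  ((\poly_(i < n) a i) * p)`_k = \sum_(j < k.+1) a j * p`_(k - j).
Proof.
move=> lkn; rewrite coefM; apply: eq_bigr => j _.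
by rewrite coef_poly (leq_trans (ltn_ord j)).
Qed.

(** The convolutions are coefficients of powers of one generating polynomial. Cutting it at degree
    $n$ is harmless, because the coefficient of index $k<n$ only involves terms of index at most
    $k$. *)
Lemma coef_poly_conv n a k : (k < n)%N ->
  [/\ ((\poly_(i < n) a i) ^+ 2)`_k = conv2 a k,
      ((\poly_(i < n) a i) ^+ 3)`_k = conv3 a k
    & ((\poly_(i < n) a i) ^+ 4)`_k = conv4 a k].
Proof.
move=> lkn.
have c1 i : (i < n)%N -> ((\poly_(i < n) a i) ^+ 1)`_i = a i.
  by move=> lin; rewrite expr1 coef_poly lin.
have lt (j i : nat) : (i < n -> i - j < n)%N by apply: leq_ltn_trans; apply: leq_subr.
have c2 i : (i < n)%N -> ((\poly_(i < n) a i) ^+ 2)`_i = conv2 a i.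
  move=> lin; rewrite exprS coef_polyM //; apply: eq_bigr => j _.
  by rewrite c1 // lt.
have c3 i : (i < n)%N -> ((\poly_(i < n) a i) ^+ 3)`_i = conv3 a i.
  move=> lin; rewrite exprS coef_polyM //; apply: eq_bigr => j _.
  rewrite c2 ?lt // mulr_sumr; apply: eq_bigr => h _.
  by rewrite mulrA.
split; [exact: c2 | exact: c3 |].
rewrite exprS coef_polyM //; apply: eq_bigr => j _.
rewrite c3 ?lt // mulr_sumr; apply: eq_bigr => h _.
rewrite mulr_sumr; apply: eq_bigr => l _.
by rewrite !mulrA.
Qed.

Lemma sum_coef (p : {poly R}) n :
  \sum_(k < n) p`_k = (take_poly n p).[1].
Proof.
rewrite (horner_coef_wide _ (size_take_poly n p)); apply: eq_bigr => i _.
by rewrite coef_take_poly ltn_ord expr1n mulr1.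
Qed.

(** Splitting indices as $ld+k$ factors the generating polynomial as $C(X^d)B(X)$. Here $\deg
    B\le(d-1)/4$, so $B^r$ has degree below $d$ for $r\le4$, and cutting at $n'd$ amounts to cutting
    $C^r$ at $n'$. Evaluation at 1 then gives the product. *)
Lemma sum_coef_exp a b c d n' r :
  (0 < d)%N -> (r <= 4)%N -> (0 < r)%N ->
  (forall l k, (l < n')%N -> (k < d)%N -> a (l * d + k)%N = c l * b k) ->
  (forall k, (k < d)%N -> (d <= 4 * k)%N -> b k = 0) ->
  \sum_(k < n' * d) ((\poly_(i < n' * d) a i) ^+ r)`_k
  = (\sum_(l < n') ((\poly_(i < n') c i) ^+ r)`_l) * (\sum_(k < d) b k) ^+ r.
Proof.
move=> d0 r4 r0 ha hb.
pose A := \poly_(i < n' * d) a i; pose B := \poly_(i < d) b i.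
pose C := \poly_(i < n') c i.
have szB : (size B <= (d.-1 %/ 4).+1)%N.
  apply/leq_sizeP => j lj; rewrite coef_poly; case: ltnP => // ljd.
  by apply: hb => //; lia.
have szBr : (size (B ^+ r) <= d)%N.
  apply: leq_trans (size_poly_exp_leq _ _) _.
  have : ((size B).-1 <= d.-1 %/ 4)%N by lia.
  by move: ((size B).-1) => u hu; nia.
have AE : A = (C \Po 'X^d) * B.
  rewrite /A /B /C !poly_def -!(big_mkord xpredT (fun i => _ i *: 'X^i)) /=.
  rewrite big_nat_mul rmorph_sum /= mulr_suml !big_mkord.
  apply: eq_bigr => l _; rewrite -{1}[(l * d)%N]add0n big_addn mulSn addnK mulr_sumr.
  rewrite !big_mkord; apply: eq_bigr => k _.
  rewrite comp_polyZ rmorphXn /= comp_polyX -exprM -scalerAl -scalerAr scalerA -exprD.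
  by rewrite addnC ha // mulnC.
have szC (p : {poly R}) : (size p <= n')%N -> (size ((p \Po 'X^d) * B ^+ r)%R
    <= n' * d)%N.
  have [-> | p0 szp] := eqVneq p 0; first by rewrite comp_poly0 mul0r size_poly0.
  have : (0 < size p)%N by rewrite size_poly_gt0.
  have h1 := size_mul_leq (p \Po 'X^d) (B ^+ r).
  have := size_comp_poly_leq p 'X^d; rewrite size_polyXn /=.
  move: (size p) (size (p \Po 'X^d)) (size (B ^+ r))
    (size ((p \Po 'X^d) * B ^+ r)) szp h1 szBr => s1 s2 s3 s4.
  clear -d0; nia.
(* The part of [p] from degree $n'$ on contributes a multiple of $X^{n'd}$; the rest has size at
   most $n'd$. *)
have take_le (p : {poly R}) : take_poly (n' * d) ((p \Po 'X^d) * B ^+ r)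
    = (take_poly n' p \Po 'X^d) * B ^+ r.
  rewrite -{1}(poly_take_drop n' p) comp_polyD comp_polyM rmorphXn /= comp_polyX mulrDl.
  rewrite -exprM (mulrAC _ ('X^_)) (mulnC d) take_polyDMXn //.
  by rewrite szC ?size_take_poly.
rewrite !sum_coef -/A AE exprMn -rmorphXn /= take_le hornerM horner_comp.
rewrite hornerXn expr1n -/C; congr (_ * _).
rewrite horner_exp; congr (_ ^+ _).
by rewrite horner_poly; apply: eq_bigr => i _; rewrite expr1n mulr1.
Qed.

Lemma sum_conv a b c d n' :
  (0 < d)%N ->
  (forall l k, (l < n')%N -> (k < d)%N -> a (l * d + k)%N = c l * b k) ->
  (forall k, (k < d)%N -> (d <= 4 * k)%N -> b k = 0) ->
  [/\ \sum_(k < n' * d) conv2 a k = (\sum_(l < n') conv2 c l) * (\sum_(k < d) b k) ^+ 2,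
      \sum_(k < n' * d) conv3 a k = (\sum_(l < n') conv3 c l) * (\sum_(k < d) b k) ^+ 3
    & \sum_(k < n' * d) conv4 a k = (\sum_(l < n') conv4 c l) * (\sum_(k < d) b k) ^+ 4].
Proof.
move=> d0 ha hb.
have conv_sum (e : nat -> R) N :
    [/\ \sum_(k < N) conv2 e k = \sum_(k < N) ((\poly_(i < N) e i) ^+ 2)`_k,
        \sum_(k < N) conv3 e k = \sum_(k < N) ((\poly_(i < N) e i) ^+ 3)`_k
      & \sum_(k < N) conv4 e k = \sum_(k < N) ((\poly_(i < N) e i) ^+ 4)`_k].
  by split; apply: eq_bigr => k _; have [h2 h3 h4] := coef_poly_conv e (ltn_ord k).
have [-> -> ->] := conv_sum a (n' * d)%N; have [-> -> ->] := conv_sum c n'.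
by split; apply: sum_coef_exp.
Qed.

End Convolution.

(** * Very-well-poised sums *)

Section WellPoised.
Variable F : fieldType.
Implicit Types q a d e x : F.

Lemma qpoch0 a q : qpoch a q 0 = 1.
Proof. by rewrite /qpoch big_ord0. Qed.

Lemma qpochS a q k : qpoch a q k.+1 = qpoch a q k * (1 - a * q ^+ k).
Proof. by rewrite /qpoch big_ord_recr. Qed.

Lemma qpochSl a q k : qpoch a q k.+1 = (1 - a) * qpoch (a * q) q k.
Proof.
rewrite /qpoch big_ord_recl expr0 mulr1; congr (_ * _).
by apply: eq_bigr => i _; rewrite /bump /= exprS mulrA.
Qed.

Lemma qpoch_neq0 a q k :
  (forall j, (j < k)%N -> a * q ^+ j != 1) -> qpoch a q k != 0.
Proof.
by move=> h; apply/prodf_neq0 => i _; rewrite subr_eq0 eq_sym h.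
Qed.

(** Summand of the terminating very-well-poised ${}_6\phi_5$ series with parameters $a,d,e,q^{-m}$.
    The first quotient is the contribution of the parameters $\pm q\sqrt a$. *)
Definition term_6phi5 q a d e (m k : nat) : F :=
  (1 - a * q ^+ k ^+ 2) / (1 - a)
  * (qpoch a q k * qpoch d q k * qpoch e q k * qpoch (q ^- m) q k)
  / (qpoch q q k * qpoch (a * q / d) q k * qpoch (a * q / e) q k
     * qpoch (a * q ^+ m.+1) q k)
  * (a * q ^+ m.+1 / (d * e)) ^+ k.

(* WZ certificate: the partial sums in [k] of the difference between the
   normalized terms for [m.+1] and [m]. *)
Definition cert_6phi5 q a d e (m k : nat) : F :=
  qpoch a q k.+1 * qpoch d q k.+1 * qpoch e q k.+1 * qpoch (q ^- m) q k
  / ((1 - a) * qpoch q q k * qpoch (a * q / d) q k * qpoch (a * q / e) q k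
     * qpoch (a * q ^+ m.+1) q k.+1)
  * (a * q ^+ m.+1 / (d * e)) ^+ k.+1 / (1 - a * q ^+ m.+1 / (d * e)).

(** Terminating form of Rogers' summation, by the WZ method: after normalization by the closed form,
    the differences of the terms for $m+1$ and $m$ telescope to [cert_6phi5], which vanishes past
    the end of the series. *)
Lemma sum_6phi5 q a d e m : q != 0 -> a != 0 -> d != 0 -> e != 0 ->
    (forall j, q ^+ j.+1 != 1) -> (forall j, a * q ^+ j != 1) ->
    (forall j, a * q ^+ j.+1 != d) -> (forall j, a * q ^+ j.+1 != e) ->
    (forall j, a * q ^+ j.+1 != d * e) ->
  \sum_(k < m.+1) term_6phi5 q a d e m k =
  qpoch (a * q) q m * qpoch (a * q / (d * e)) q m
  / (qpoch (a * q / d) q m * qpoch (a * q / e) q m).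
Proof.
move=> q0 a0 d0 e0 hq ha hd he hde.
have nz_sub (u v : F) : u != v -> v - u != 0 by rewrite subr_eq0 eq_sym.
have Dd j : 1 - a * q / d * q ^+ j != 0.
  rewrite nz_sub //; apply: contra (hd j) => /eqP h; apply/eqP.
  by rewrite -[d in RHS]mul1r -h exprS; field.
have De j : 1 - a * q / e * q ^+ j != 0.
  rewrite nz_sub //; apply: contra (he j) => /eqP h; apply/eqP.
  by rewrite -[e in RHS]mul1r -h exprS; field.
have Dde j : 1 - a * q ^+ j.+1 / (d * e) != 0.
  rewrite nz_sub //; apply: contra (hde j) => /eqP h; apply/eqP.
  by rewrite -[d * e in RHS]mul1r -h; field; rewrite d0 e0.
have Da j : 1 - a * q ^+ j != 0 by rewrite nz_sub.
have Dq j : 1 - q ^+ j.+1 != 0 by rewrite nz_sub.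
have Pq k : qpoch q q k != 0.
  by apply: qpoch_neq0 => j _; rewrite -exprS.
have Pd k : qpoch (a * q / d) q k != 0.
  by apply: qpoch_neq0 => j _; rewrite eq_sym -subr_eq0.
have Pe k : qpoch (a * q / e) q k != 0.
  by apply: qpoch_neq0 => j _; rewrite eq_sym -subr_eq0.
have Pm l k : qpoch (a * q ^+ l.+1) q k != 0.
  by apply: qpoch_neq0 => j _; rewrite -mulrA -exprD.
(* Quotient of the closed form at [l] by the one at [l.+1]. *)
pose c l := (1 - a * q / d * q ^+ l) * (1 - a * q / e * q ^+ l)
   / ((1 - a * q ^+ l.+1) * (1 - a * q ^+ l.+1 / (d * e))).
have key l K : \sum_(k < K.+1) (c l * term_6phi5 q a d e l.+1 k - term_6phi5 q a d e l k)
   = cert_6phi5 q a d e l K.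
  have shift k : qpoch (a * q ^+ l.+2) q k
      = qpoch (a * q ^+ l.+1) q k.+1 / (1 - a * q ^+ l.+1).
    by rewrite qpochSl -mulrA -exprSr mulrAC divff ?mul1r.
  have shiftV k : qpoch (q ^- l.+1) q k.+1 = (1 - q ^- l.+1) * qpoch (q ^- l) q k.
    by rewrite qpochSl exprSr invfM mulfVK.
  have z0 : q ^+ l != 0 by rewrite expf_neq0.
  elim: K => [|K IH].
    rewrite big_ord1 /term_6phi5 /cert_6phi5 /c !qpoch0 !qpochS !qpoch0 !expr0 !mulr1.
    have := Da 0; rewrite expr0 mulr1 => Da0.
    have := nz_sub _ _ (hd l); have := nz_sub _ _ (he l).
    have := nz_sub _ _ (hde l); have := Da l.+1.
    rewrite exprS; set v := q ^+ l => Da1 Dde1 De1 Dd1.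
    by field; rewrite e0 d0 Dde1 Da1 Da0 oner_neq0.
  rewrite big_ord_recr /= IH /term_6phi5 /cert_6phi5 /c shift shiftV.
  have := Da 0; rewrite expr0 mulr1 => Da0.
  have := nz_sub _ _ (hd l); have := nz_sub _ _ (he l).
  have := nz_sub _ _ (hde l); have := Da l.+1.
  have -> : a * q ^+ l.+2 / (d * e) = a * q ^+ l.+1 / (d * e) * q.
    by rewrite exprSr; field; rewrite d0 e0.
  have := nz_sub _ _ (hd K); have := nz_sub _ _ (he K).
  have := Da (l.+1 + K)%N; have := Da (l.+1 + K.+1)%N; have := Dq K.
  have := Pq K; have := Pd K; have := Pe K; have := Pm l K.
  have zE : a * q ^+ l.+1 / (d * e) = a * (q * q ^+ l) / (d * e) by rewrite -exprS.
  move: (a * q ^+ l.+1 / (d * e)) zE => z zE.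
  rewrite (exprMn _ z q) !exprD !(qpochS _ _ K.+1) !(qpochS _ _ K) !expr2 !exprS zE.
  move: (z ^+ K) => Z; set v := q ^+ l in z0 *; set y := q ^+ K.
  move: (qpoch a q K) (qpoch d q K) (qpoch e q K) (qpoch (v^-1) q K)
    (qpoch q q K) (qpoch _ q K) (qpoch _ q K) (qpoch _ q K) => p1 p2 p3 p4 p5 p6 p7 p8.
  clear -q0 d0 e0 a0 z0 Da0.
  move=> *.
  by field; rewrite -?(mulrA a); do ![apply/andP; split => //].
(* The factor $1-q^{-l}q^l$ kills both the certificate at [K = l.+1] and the extra term of that
   index in the series for [l]. *)
have van l : qpoch (q ^- l) q l.+1 = 0.
  by rewrite qpochS mulVf ?subrr ?mulr0 // expf_neq0.
have T0 l : term_6phi5 q a d e l l.+1 = 0.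
  by rewrite /term_6phi5 van !(mulr0, mul0r).
have step l : c l * \sum_(k < l.+2) term_6phi5 q a d e l.+1 k
    = \sum_(k < l.+1) term_6phi5 q a d e l k.
  have := key l l.+1; rewrite sumrB -mulr_sumr [in X in _ - X]big_ord_recr /= T0 addr0.
  by rewrite /cert_6phi5 van !(mulr0, mul0r) => /subr0_eq.
elim: m => [|m IH].
  rewrite big_ord1 /term_6phi5 !qpoch0 !expr0 !mulr1 expr1n mulr1 !divr1 divff //.
  by have := Da 0; rewrite expr0 mulr1.
have c0 : c m != 0 by rewrite /c mulf_neq0 ?invr_neq0 ?mulf_neq0.
apply: (mulfI c0); rewrite step IH /c !qpochS.
have E1 u : u * q * q ^+ m = u * q ^+ m.+1 by rewrite exprS mulrA.
have E2 u : a * q / u * q ^+ m = a * q ^+ m.+1 / u.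
  by rewrite exprS mulrAC mulrA.
have := Dd m; have := De m; have := Dde m; have := Da m.+1; have := Pd m; have := Pe m.
rewrite !E1 !E2.
move: (qpoch _ _ _) (qpoch _ _ _) (qpoch _ _ _) (qpoch _ _ _).
move: (1 - _) (1 - _) (1 - _) (1 - _) => x1 x2 x3 x4 y1 y2 y3 y4 *.
field; do ![apply/andP; split => //].
Qed.

(** * Closed form of the sum of $\alpha$ at $x=q^{-2n}$ *)

Lemma qpoch_flip c q m : q != 0 -> c != 0 ->
  qpoch (q / (c * q ^+ m)) q m * c ^+ m
  = \prod_(i < m) (- (q ^+ i)^-1) * qpoch c q m.
Proof.
(* In reversed order the factor of index $i$ is $1-1/(cq^i)$, and
   $c(1-1/(cq^i))=-q^{-i}(1-cq^i)$. *)
move=> q0 c0; rewrite /qpoch (reindex_inj rev_ord_inj) /=.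
have -> : c ^+ m = \prod_(i < m) c by rewrite prodr_const card_ord.
rewrite -!big_split /=; apply: eq_bigr => i _.
have qi0 : q ^+ i != 0 by rewrite expf_neq0.
have -> : q ^+ m = q * q ^+ i * q ^+ (m - i.+1).
  by rewrite -exprS -exprD subnKC.
by field; rewrite c0 q0 qi0 expf_neq0.
Qed.

Lemma qpoch_shift a q k :
  qpoch a q k * (1 - a * q ^+ k) = (1 - a) * qpoch (a * q) q k.
Proof. by rewrite -qpochS qpochSl. Qed.

Lemma expf_inj q : q != 0 -> (forall j, q ^+ j.+1 != 1) ->
  injective (fun i => q ^+ i).
Proof.
move=> q0 hq; suff H i j : (i < j)%N -> q ^+ i != q ^+ j.
  by move=> i j /= /eqP; case: (ltngtP i j) => // /H /negbTE; rewrite 1?eq_sym => ->.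
move=> lij; rewrite -(subnKC lij) addSnnS exprD -{1}[q ^+ i]mulr1.
by apply: contra (hq (j - i.+1)%N) => /eqP/(mulfI (expf_neq0 i q0)) <-.
Qed.

(** At this $x$ the four products involving $x$ become $(Q^{-m};Q)_k$, $(e;Q)_k$, $(aQ/e;Q)_k$ and
    $(aQ^{m+1};Q)_k$, so only $(1-qQ^k)^2$ separates [alphaq] from a very-well-poised term. In its
    splitting, $(1-eQ^k)(1-aQ^k/e)$ moves the parameter $e$ to $eQ$, and $Q^k$ changes the argument
    from $q^{-4}$ to $q^4$. *)
Lemma alphaq_6phi5 q m k (x := q ^- (2 * (4 * m + 1))) (e := q ^+ (4 + 8 * m))
    (a := q ^+ 2) (Q := q ^+ 8) :
    q != 0 -> (forall j, q ^+ j.+1 != 1) ->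
  alphaq q x k * (1 - q) ^+ 2
  = (1 - e) * (1 - a / e) * term_6phi5 Q a a (e * Q) m k
    + (e - q) ^+ 2 / e * term_6phi5 Q a a e m k.
Proof.
have E8 : (8 * k + 1 = (4 * k * 2).+1)%N by lia.
have E8' : (8 * k = 4 * k * 2)%N by lia.
have E16 : (2 * (8 * k + 1) = 2 + 4 * k * 4)%N by lia.
move=> q0 hq; have inj := expf_inj q0 hq.
have qX0 i : q ^+ i != 0 by rewrite expf_neq0.
have ne i j : (i != j)%N -> 1 - q ^+ i / q ^+ j != 0.
  move=> nij; rewrite subr_eq0 eq_sym; apply: contra nij => /eqP h.
  by apply/eqP/inj; rewrite /= -[LHS](divfK (qX0 j)) h mul1r.
have e0 : e != 0 := qX0 _.
have Q0 : Q != 0 := qX0 _.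
have QX i : Q ^+ i = q ^+ (8 * i) by rewrite exprM.
have Ea : x * q ^+ 2 = Q ^- m.
  rewrite /x QX mulnDr exprD invfM mulfVK //; congr (q ^- _); lia.
have Eb : q ^+ 2 / x = e.
  by rewrite /x invrK -exprD /e; congr (_ ^+ _); lia.
have Ec : x * q ^+ 8 = a * Q / e.
  apply: (mulIf e0); rewrite divfK // /a /Q /e -exprD /x.
  rewrite -mulrA -exprD [q ^+ (8 + _)](_ : _ = q ^+ (2 + 8) * q ^+ (2 * (4 * m + 1))).
    by rewrite mulrCA mulVf ?mulr1.
  by rewrite -exprD; congr (_ ^+ _); lia.
have Ed : q ^+ 8 / x = a * Q ^+ m.+1.
  by rewrite /x invrK QX -!exprD; congr (_ ^+ _); lia.
have PQ : qpoch Q Q k != 0.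
  apply: qpoch_neq0 => j _; rewrite -exprS QX -[1](expr0 q).
  by apply/negP => /eqP/inj; lia.
have Pe : qpoch (a * Q / e) Q k != 0.
  apply: qpoch_neq0 => j _; rewrite QX mulrAC -!exprD.
  by rewrite eq_sym -subr_eq0 ne //; apply/eqP; lia.
have Pm : qpoch (a * Q ^+ m.+1) Q k != 0.
  apply: qpoch_neq0 => j _; rewrite !QX -!exprD -[1](expr0 q).
  by apply/negP => /eqP/inj; lia.
have a1 : 1 - a != 0 by rewrite -(divr1 a) -(expr0 q) ne.
have s1 : 1 - q != 0 by rewrite -(divr1 q) -{1}(expr1 q) -(expr0 q) ne.
have ea : 1 - a / e != 0 by rewrite ne //; apply/eqP; lia.
have eak : 1 - a / e * Q ^+ k != 0.
  by rewrite QX mulrAC -exprD ne //; apply/eqP; lia.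
have e1 : 1 - e != 0 by rewrite -(divr1 e) -(expr0 q) ne //; apply/eqP; lia.
rewrite /alphaq /term_6phi5 Ea Eb Ec Ed.
have -> : a * Q ^+ m.+1 / (a * (e * Q)) = q ^- 4.
  rewrite exprS QX /e /Q exprD; field.
  by rewrite q0 !qX0.
have -> : a * Q ^+ m.+1 / (a * e) = q ^+ 4.
  rewrite exprS QX /e /Q exprD; field.
  by rewrite q0 !qX0.
have -> : a * Q / (e * Q) = a / e by field; rewrite e0 Q0.
have -> : a * Q / a = Q by field; rewrite qX0.
have -> : qpoch (e * Q) Q k = qpoch e Q k * (1 - e * Q ^+ k) / (1 - e).
  by rewrite qpoch_shift [RHS]mulrC mulKf.
have -> : qpoch (a / e) Q k = (1 - a / e) * qpoch (a * Q / e) Q k / (1 - a / e * Q ^+ k).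
  by rewrite (mulrAC a) -qpoch_shift mulfK.
have tk : q ^+ (4 * k) != 0 := qX0 _.
have -> : qint q (8 * k + 1) = (1 - q * q ^+ (4 * k) ^+ 2) / (1 - q).
  by rewrite /qint -exprM -exprS E8.
have -> : qint (q ^+ 2) (8 * k + 1) = (1 - a * q ^+ (4 * k) ^+ 4) / (1 - a).
  by rewrite /qint -!exprM -exprD E16.
rewrite -[(q ^+ 4) ^+ k]exprM exprVn -[(q ^+ 4) ^+ k]exprM -/a -/Q.
have yE : Q ^+ k = q ^+ (4 * k) ^+ 2 by rewrite QX -exprM E8'.
have eak' : e - a * q ^+ (4 * k) ^+ 2 != 0.
  move: eak; rewrite yE; apply: contra => /eqP h; apply/eqP.
  by apply: (mulIf e0); rewrite mul0r -h; field.
have ea' : e - a != 0.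
  move: ea; apply: contra => /eqP h; apply/eqP.
  by apply: (mulIf e0); rewrite mul0r -h; field.
rewrite yE.
move: (qpoch (Q ^- m) Q k) PQ Pe Pm tk eak'.
move: (qpoch _ _ _) (qpoch _ _ _) (qpoch _ _ _) (qpoch _ _ _) (qpoch _ _ _).
move: (q ^+ (4 * k)) => t p1 p2 p3 p4 p5 p6 h1 h2 h3 h4 h5.
rewrite /a in a1 ea' h5 *; clear -e0 q0 a1 s1 e1 ea' h1 h2 h3 h4 h5.
clearbody e.
have h6 : 1 - q ^+ 2 / e * t ^+ 2 != 0.
  apply: contra h5 => /eqP h; apply/eqP.
  by rewrite -[RHS](mulr0 e) -h; field.
have h7 : 1 - q ^+ 2 / e != 0.
  apply: contra ea' => /eqP h; apply/eqP.
  by rewrite -[RHS](mulr0 e) -h; field.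
(* With $t=q^{4k}$ and $Q^k=t^2$, [Y] gathers every factor other than $(1-qQ^k)^2q^{-4k}$. *)
pose Y := p2 ^+ 2 * p6 * p1 / (p5 ^+ 2 * p4 * p3)
  * ((1 - q ^+ 2 * t ^+ 4) / (1 - q ^+ 2)).
transitivity (Y * ((1 - q * t ^+ 2) ^+ 2 / t)).
  rewrite /Y; move: (1 - q ^+ 2 * _) (1 - q ^+ 2) (1 - q * _) (1 - q) a1 s1 => *.
  by field; do ![apply/andP; split => //].
transitivity (Y * ((1 - e * t ^+ 2) * (1 - q ^+ 2 / e * t ^+ 2) / t + (e - q) ^+ 2 / e * t)).
  by congr (_ * _); field; rewrite e0.
rewrite -[t ^+ 2 ^+ 2]exprM mulrDr; congr (_ + _); rewrite /Y.
  move: (1 - q ^+ 2 * _) (1 - q ^+ 2) (1 - e * _) (1 - e) (1 - q ^+ 2 / e * _)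
    (1 - q ^+ 2 / e) a1 e1 h6 h7 => *.
  by field; do ![apply/andP; split => //].
move: (1 - q ^+ 2 * _) (1 - q ^+ 2) a1 => *.
by field; do ![apply/andP; split => //].
Qed.

(** The closed forms of the two pieces differ by shifts of the products in $Q/e$ and $aQ/e$. Since
    $e=q^4Q^m$, reversal turns these into $(q^4;Q)_m$ and $(a;Q)_m$, the second of which cancels,
    and leaves the power $q^{-2m}$. The two weights add up to a multiple of $E$. *)
Lemma alphaq_sum q m (n := (4 * m + 1)%N) (x := q ^- (2 * n)) :
    q != 0 -> (forall j, q ^+ j.+1 != 1) ->
  \sum_(k < m.+1) alphaq q x k
  = qint (q ^+ 2) n * (qpoch (q ^+ 4) (q ^+ 8) m / qpoch (q ^+ 8) (q ^+ 8) m)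
    * q ^- (2 * m) * Efac q x.
Proof.
move=> q0 hq; have inj := expf_inj q0 hq.
have qX0 i : q ^+ i != 0 by rewrite expf_neq0.
have neX i j : (i != j)%N -> q ^+ i != q ^+ j by apply: contra => /eqP/inj/eqP.
have ne i j : (i != j)%N -> 1 - q ^+ i / q ^+ j != 0.
  move=> nij; rewrite subr_eq0 eq_sym; apply: contra nij => /eqP h.
  by apply/eqP/inj; rewrite /= -[LHS](divfK (qX0 j)) h mul1r.
have s1 : 1 - q != 0 by rewrite -(divr1 q) -{1}(expr1 q) -(expr0 q) ne.
apply: (mulIf (expf_neq0 2 s1)); rewrite mulr_suml.
under eq_bigr do rewrite alphaq_6phi5 //.
set e := q ^+ (4 + 8 * m); set a := q ^+ 2; set Q := q ^+ 8.
have e0 : e != 0 := qX0 _.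
have Q0 : Q != 0 := qX0 _.
have a0 : a != 0 := qX0 _.
have QX i : Q ^+ i = q ^+ (8 * i) by rewrite exprM.
have hQ j : Q ^+ j.+1 != 1 by rewrite QX -(expr0 q) neX.
have hfact (i j : nat) : i <> j -> q ^+ i != q ^+ j by move/eqP; apply: neX.
have h1 j : a * Q ^+ j != 1 by rewrite QX -!exprD -(expr0 q) hfact //; lia.
have h2 j : a * Q ^+ j.+1 != a by rewrite QX -!exprD hfact //; lia.
have h3 j : a * Q ^+ j.+1 != e by rewrite QX -!exprD hfact //; lia.
have h4 j : a * Q ^+ j.+1 != e * Q by rewrite QX -!exprD hfact //; lia.
have h5 j : a * Q ^+ j.+1 != a * e by rewrite QX -!exprD hfact //; lia.
have h6 j : a * Q ^+ j.+1 != a * (e * Q) by rewrite QX -!exprD hfact //; lia.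
have eQ0 := mulf_neq0 e0 Q0.
rewrite big_split /= -!mulr_sumr !sum_6phi5 //.
have nQ : q ^+ (2 * n) = a * Q ^+ m by rewrite QX -exprD; congr (_ ^+ _); lia.
have nE : qint (q ^+ 2) n = (1 - a * Q ^+ m) / (1 - a) by rewrite /qint -exprM nQ.
have eE : e = q ^+ 4 * Q ^+ m by rewrite QX -exprD.
have w0 : Q ^+ m != 0 by rewrite QX.
have q2 : 1 + a != 0.
  have : 1 - q ^+ 4 / q ^+ 0 != 0 by rewrite ne.
  have -> : 1 - q ^+ 4 / q ^+ 0 = (1 - a) * (1 + a) by rewrite expr0 divr1 /a; ring.
  by rewrite mulf_eq0 => /norP[].
have Pe : qpoch (a * Q / e) Q m != 0.
  apply: qpoch_neq0 => j _; rewrite QX mulrAC -!exprD.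
  by rewrite eq_sym -subr_eq0 ne //; apply/eqP; lia.
have PQ : qpoch Q Q m != 0 by apply: qpoch_neq0 => j _; rewrite -exprS.
have a1 : 1 - a != 0 by rewrite -(divr1 a) -(expr0 q) ne.
have -> : a * Q / (a * (e * Q)) = 1 / e by field; rewrite e0 a0 Q0.
have -> : a * Q / (a * e) = 1 / e * Q by field; rewrite e0 a0.
have -> : a * Q / (e * Q) = a / e by field; rewrite Q0 e0.
have -> : a * Q / a = Q by field; rewrite a0.
have k1 : qpoch (a * Q) Q m = qpoch a Q m * (1 - a * Q ^+ m) / (1 - a).
  by rewrite qpoch_shift [RHS]mulrC mulKf.
have f4 : 1 - 1 / e * Q ^+ m = 1 - q ^- 4 by rewrite eE; field; rewrite w0 q0.
have f2 : 1 - a / e * Q ^+ m = 1 - q ^- 2.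
  by rewrite eE /a; field; rewrite w0 q0.
have n4 : 1 - q ^- 4 != 0.
  by rewrite -[q ^- 4]mul1r -(expr0 q) ne.
have n2 : 1 - q ^- 2 != 0.
  by rewrite -[q ^- 2]mul1r -(expr0 q) ne.
have k2 : qpoch (1 / e) Q m = (1 - 1 / e) * qpoch (1 / e * Q) Q m / (1 - q ^- 4).
  by rewrite -qpoch_shift f4 mulfK.
have k3 : qpoch (a / e) Q m = (1 - a / e) * qpoch (a * Q / e) Q m / (1 - q ^- 2).
  by rewrite [a * Q / e]mulrAC -qpoch_shift f2 mulfK.
have := qpoch_flip m Q0 a0; have := qpoch_flip m Q0 (qX0 4).
have -> : Q / (q ^+ 4 * Q ^+ m) = 1 / e * Q by rewrite eE mulrC; field; rewrite w0 q0.
have -> : Q / (a * Q ^+ m) = a * Q / e by rewrite eE /a; field; rewrite w0 q0.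
have K0 : \prod_(i < m) - (Q ^+ i)^-1 != 0.
  by apply/prodf_neq0 => i _; rewrite oppr_eq0 invr_eq0 expf_neq0.
rewrite -[q ^+ 4 ^+ m]exprM -[a ^+ m]exprM.
have -> : q ^+ (4 * m) = q ^+ (2 * m) ^+ 2 by rewrite -exprM -mulnA (mulnC m) mulnA.
move: (q ^+ (2 * m)) (qX0 (2 * m)%N) => u u0.
move: (\prod_(i < m) _) K0 => K K0.
rewrite k1 k2 k3 nE /Efac.
have -> : x * q ^+ 2 = q ^+ 4 / e.
  by rewrite /x eE nQ /a; field; rewrite w0 q0.
have -> : q ^+ 2 / x = e.
  by rewrite /x invrK nQ eE /a; ring.
move: (qpoch (1 / e * Q) Q m) (qpoch (a * Q / e) Q m) Pe => P1 P2 P20 hP1 hP2.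
have {}hP1 : P1 = K * qpoch (q ^+ 4) Q m / u ^+ 2 by rewrite -hP1 mulfK ?expf_neq0.
have {}hP2 : qpoch a Q m = P2 * u / K by rewrite hP2 [K * _]mulrC mulfK.
rewrite hP2 {P1}hP1.
have ae0 : 1 - a / e != 0 by rewrite ne //; apply/eqP; lia.
have q40 : 1 - q ^+ 4 != 0 by rewrite -[q ^+ 4]divr1 -(expr0 q) ne.
(* The left side collects the weights of the two pieces once their common product is taken out; the
   right side is $E(1-q)^2$ at this $x$. *)
have E2 : (1 - e) * (1 - 1 / e) * (1 - q ^- 2) / (1 - q ^- 4) + (e - q) ^+ 2 / e
    = (1 - (1 - q ^+ 4 / e) * (1 - e) / ((1 - q) ^+ 2 * (1 + q ^+ 2))) * (1 - q) ^+ 2.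
  rewrite -[X in X + _]mulrA.
  have -> : (1 - q ^- 2) / (1 - q ^- 4) = q ^+ 2 / (1 + q ^+ 2).
    have -> : 1 - q ^- 4 = (1 - q ^- 2) * (1 + q ^+ 2) / q ^+ 2.
      by field.
    have n2' : q ^+ 2 - 1 != 0 by rewrite -opprB oppr_eq0.
    by field; rewrite ?q0 ?n2' ?andbT //=; apply: q2.
  by clear -e0 s1 q2; clearbody e; field; rewrite q2 s1 e0.
rewrite -(mulrA (_ / u)) -E2.
move: (1 - a / e) (1 - q ^- 2) (1 - q ^- 4) (qpoch _ _ _) (qpoch _ _ _) ae0 n2 n4 PQ.
move: (1 - a * _) (1 - a) a1 (1 / e) ((e - q) ^+ 2 / e) (1 - e) => *.
by field; do ![apply/andP; split => //].
Qed.

(** * Symmetries and zeros of $\alpha$ *)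

Lemma Efac_inv q x : Efac q x^-1 = Efac q x.
Proof. by rewrite /Efac invrK (mulrC x^-1) [x * _]mulrC (mulrC (1 - _ / x)). Qed.

(** This symmetry reduces the specialization $x=q^{2n}$ to $x=q^{-2n}$. *)
Lemma alphaq_inv q x k : alphaq q x^-1 k = alphaq q x k.
Proof.
rewrite /alphaq invrK ![x^-1 * _]mulrC ![x * _]mulrC.
by rewrite -![qpoch _ _ _ ^+ 2 * _ * _]mulrA !(mulrC (qpoch (_ / x) _ _)).
Qed.

(** The factor of index $i$ in $(xq^2;q^8)_k$ is $1-xq^{2(4i+1)}$. *)
Lemma alphaq_eq0 q x i k : x = q ^- (2 * (4 * i + 1)) -> q != 0 -> (i < k)%N ->
  alphaq q x k = 0.
Proof.
move=> -> q0 lik; rewrite /alphaq.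
suff -> : qpoch (q ^- (2 * (4 * i + 1)) * q ^+ 2) (q ^+ 8) k = 0.
  by rewrite !(mulr0, mul0r).
apply/eqP/prodf_eq0; exists (Ordinal lik) => //=.
rewrite -exprM -mulrA -exprD.
have -> : (2 + 8 * i = 2 * (4 * i + 1))%N by lia.
by rewrite mulVf ?subrr ?expf_neq0.
Qed.

(** Induction on [j]: since $(fq^{m-j-1})(aq^{j+1}/f)=aq^m=1$, the factor $1-fq^{m-j-1}$ lost by the
    first product equals, up to a monomial, the factor gained by the second. *)
Lemma qpoch_compl a q f m j : f != 0 -> a * q ^+ m = 1 -> (j <= m)%N ->
  qpoch f q (m - j) * qpoch (a * q / f) q j * f ^+ j
  = qpoch f q m * \prod_(i < j) (- (a * q ^+ i.+1)).
Proof.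
move=> f0 am; elim: j => [|j IH] ljm.
  by rewrite qpoch0 big_ord0 subn0 expr0 !mulr1.
rewrite big_ord_recr /= mulrA -IH ?(ltnW ljm) // qpochS exprSr.
rewrite -(subnSK ljm) qpochS.
have -> : 1 - a * q / f * q ^+ j = - (a * q ^+ j.+1) * (1 - f * q ^+ (m - j.+1)) / f.
  have E : a * q ^+ j.+1 * q ^+ (m - j.+1) = 1 by rewrite -mulrA -exprD subnKC.
  rewrite mulNr mulrBr mulr1 [_ * (f * _)]mulrCA E mulr1 exprS.
  by field.
by field.
Qed.

(** With $Q=q^8$ and $a=q^2$, the condition $q^{8m+2}=1$ reads $aQ^m=1$. For $f=a,a,xa,a/x$ each
    quotient $(f;Q)_j/(aQ/f;Q)_j$ is then, up to a constant and a monomial, symmetric under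
    $j\mapsto m-j$. The sign comes from $(1-y)^2(1-y^2)/y^2$ with $y=q^{8j+1}$, which is odd under
    $y\mapsto1/y$. *)
Lemma alphaq_antisym q x m k : q != 0 -> x != 0 -> q ^+ (8 * m + 2) = 1 ->
  q != 1 -> q ^+ 2 != 1 ->
  (forall j, (j < m)%N -> q ^+ (8 * j.+1) != 1) ->
  (forall j, x * q ^+ (8 * j.+1) != 1) ->
  (forall j, q ^+ (8 * j.+1) / x != 1) ->
  (k <= m)%N -> alphaq q x (m - k) = - alphaq q x k.
Proof.
have N1 j : (16 * j * j + 24 * j + (2 + 8 * j.+1) * 4 = 16 * j.+1 * j.+1 + 24 * j.+1)%N by lia.
have N2 j : (8 * j + 1 = (4 * j * 2).+1)%N by lia.
have N3 j : (2 * (j * 2) + 2 * (2 * j) = 8 * j)%N by lia.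
have N4 j r : (16 * j * j + 24 * j + 16 * j * r
    = 8 * j + 4 * j * 3 + (8 * (j + r) + 2) * (2 * j))%N by lia.
have N5 : (k <= m)%N -> (8 * (m - k) + 1 + (8 * k + 1) = 8 * m + 2)%N by lia.
have N6 r : (16 * r * k = 16 * k * r)%N by lia.
move=> q0 x0 qm q1 q21 hq hx hx' lkm.
pose Q := q ^+ 8; pose a := q ^+ 2.
have am : a * Q ^+ m = 1 by rewrite -exprM -exprD addnC.
pose c j := \prod_(i < j) (- (a * Q ^+ i.+1)).
pose sym f j := qpoch f Q j * qpoch f Q (m - j).
have nz j : (j <= m)%N -> qpoch Q Q j != 0.
  by move=> ljm; apply: qpoch_neq0 => i lij; rewrite -exprS -exprM hq // (leq_trans lij).
have nzx j : qpoch (x * Q) Q j != 0.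
  by apply: qpoch_neq0 => i _; rewrite -mulrA -exprS -exprM hx.
have nzx' j : qpoch (Q / x) Q j != 0.
  by apply: qpoch_neq0 => i _; rewrite mulrAC -exprS -exprM hx'.
have nzf f : f != 0 -> qpoch (a * Q / f) Q m != 0 -> qpoch f Q m != 0.
  move=> f0 nzm; have := qpoch_compl f0 am (leqnn m).
  rewrite subnn qpoch0 mul1r => h.
  have := mulf_neq0 nzm (expf_neq0 m f0); rewrite h.
  by rewrite mulf_eq0 => /norP[].
have a0 : a != 0 by rewrite expf_neq0.
pose f1 := x * a; pose f2 := a / x.
have f10 : f1 != 0 by rewrite mulf_neq0.
have f20 : f2 != 0 by rewrite mulf_neq0 ?invr_neq0.
have A0 : a * Q / a = Q by field.
have A1 : a * Q / f1 = Q / x by rewrite /f1; field; rewrite x0 a0.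
have A2 : a * Q / f2 = x * Q by rewrite /f2; field; rewrite x0 a0.
have pm0 : qpoch a Q m != 0 by rewrite nzf ?A0 ?nz.
have pm1 : qpoch f1 Q m != 0 by rewrite nzf ?A1.
have pm2 : qpoch f2 Q m != 0 by rewrite nzf ?A2.
(* Four quotients occur, so only the fourth power of [c j] matters and its sign drops out. *)
have cE j : c j ^+ 4 = q ^+ (16 * j * j + 24 * j).
  elim: j => [|j IH]; first by rewrite /c big_ord0 expr1n.
  rewrite /c big_ord_recr /= -/(c j) exprMn IH.
  have -> : (- (a * Q ^+ j.+1)) ^+ 4 = (a * Q ^+ j.+1) ^+ 4 by ring.
  rewrite -!(exprM, exprD).
  by rewrite N1.
have c0 j : c j != 0.
  by have := expf_neq0 (16 * j * j + 24 * j) q0; rewrite -cE expf_eq0.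
have rho f j : f != 0 -> (j <= m)%N -> qpoch (a * Q / f) Q j != 0 -> qpoch f Q m != 0 ->
    qpoch f Q j / qpoch (a * Q / f) Q j = sym f j * f ^+ j / (qpoch f Q m * c j).
  move=> f0 ljm nzj nzm; have := qpoch_compl f0 am ljm; rewrite -/(c j) /sym => <-.
  have : qpoch f Q (m - j) != 0.
    apply/prodf_neq0 => i _; apply: (contraNneq _ nzm) => h.
    have lim : (i < m)%N by rewrite (leq_trans (ltn_ord i)) ?leq_subr.
    by rewrite /qpoch (bigD1 (Ordinal lim)) //= h mul0r.
  have : f ^+ j != 0 by rewrite expf_neq0.
  move: (f ^+ j) (qpoch _ _ _) (qpoch _ _ _) (qpoch _ _ _) nzj => *.
  by field; do ![apply/andP; split => //].
pose S j := sym a j ^+ 2 * sym f1 j * sym f2 j.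
pose y j := q ^+ (8 * j + 1).
pose K := q ^+ 2 / ((1 - q) ^+ 2 * (1 - a) * (qpoch a Q m ^+ 2 * qpoch f1 Q m * qpoch f2 Q m)).
(* Only the last factor is not symmetric under [j -> m - j], where [y] becomes its inverse. *)
have form j : (j <= m)%N ->
  alphaq q x j = K * (S j * q ^+ (16 * j * (m - j))) * ((1 - y j) ^+ 2 * (1 - y j ^+ 2) / y j ^+ 2).
  move=> ljm.
  have q10 : 1 - q != 0 by rewrite subr_eq0 eq_sym.
  have a10 : 1 - a != 0 by rewrite subr_eq0 eq_sym.
  have ya : q ^+ (8 * j + 1) = q ^+ (4 * j) ^+ 2 * q.
    by rewrite -exprM -exprSr N2.
  have ra := rho _ _ a0 ljm; rewrite A0 in ra.
  have r1 := rho _ _ f10 ljm; rewrite A1 in r1.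
  have r2 := rho _ _ f20 ljm; rewrite A2 in r2.
  have nj := nz _ ljm; have n1 := nzx j; have n2 := nzx' j.
  have {}ra := ra nj pm0.
  have {}r1 := r1 n2 pm1.
  have {}r2 := r2 n1 pm2.
  have -> : alphaq q x j = q ^- (4 * j) * ((1 - y j) / (1 - q)) ^+ 2 * ((1 - y j ^+ 2) / (1 - a))
     * ((qpoch a Q j / qpoch Q Q j) ^+ 2 * (qpoch f1 Q j / qpoch (Q / x) Q j)
        * (qpoch f2 Q j / qpoch (x * Q) Q j)).
    rewrite /alphaq /qint -[(q ^+ 2) ^+ _]exprM (mulnC 2%N) [q ^+ (_ * 2)]exprM.
    rewrite -/(y j) -/a -/Q -/f1 -/f2.
    congr (_ * _).
    move: (qpoch a _ _) (qpoch Q _ _) (qpoch f1 _ _) (qpoch f2 _ _) (qpoch (x * Q) _ _)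
      (qpoch (Q / x) _ _) nj n1 n2 => *.
    by field; do ![apply/andP; split => //].
  rewrite ra r1 r2 /K /S.
  (* Reduction by $q^{8m+2}=1$ brings the exponent to the symmetric form $16j(m-j)$. *)
  have W : a ^+ j ^+ 2 * f1 ^+ j * f2 ^+ j * (q ^+ (4 * j) ^+ 3)
      = c j ^+ 4 * q ^+ (16 * j * (m - j)).
    have -> : a ^+ j ^+ 2 * f1 ^+ j * f2 ^+ j = q ^+ (8 * j).
      rewrite -(mulrA _ (f1 ^+ j)) -exprMn.
      have -> : f1 * f2 = a ^+ 2 by rewrite /f1 /f2; field.
      by rewrite -!exprM -exprD N3.
    rewrite cE -exprM -!exprD.
    have := N4 j (m - j)%N; rewrite subnKC // => ->.
    by rewrite [RHS]exprD (exprM q (8 * m + 2)) qm expr1n mulr1.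
  have {}W : q ^+ (16 * j * (m - j))
      = a ^+ j ^+ 2 * f1 ^+ j * f2 ^+ j * q ^+ (4 * j) ^+ 3 / c j ^+ 4.
    by rewrite W mulrC mulKf ?expf_neq0.
  have := c0 j; have := expf_neq0 (4 * j) q0.
  have yE : y j = q ^+ (4 * j) ^+ 2 * q by rewrite /y ya.
  (* This exposes the factor $y^{-2}$ that makes the last factor odd. *)
  have -> : q ^- (4 * j) = q ^+ 2 * q ^+ (4 * j) ^+ 3 / y j ^+ 2.
    by rewrite yE; field; rewrite q0 expf_neq0.
  rewrite W.
  have : y j != 0 by rewrite expf_neq0.
  move: (c j) (y j) (sym a j) (sym f1 j) (sym f2 j) (q ^+ (4 * j)) (a ^+ j) (f1 ^+ j) (f2 ^+ j).
  move: (qpoch a Q m) (qpoch f1 Q m) (qpoch f2 Q m) (1 - a) (1 - q) pm0 pm1 pm2 a10 q10 => *.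
  by field; do ![apply/andP; split => //].
have yy : y (m - k)%N = (y k)^-1.
  apply: (mulIf (expf_neq0 (8 * k + 1) q0)); rewrite mulVf ?expf_neq0 // -exprD -[RHS]qm.
  by rewrite N5.
rewrite !form ?leq_subr // subKn // yy.
have -> : S (m - k)%N = S k.
  by rewrite /S /sym subKn //; ring.
rewrite N6.
rewrite -[RHS]mulrN; congr (_ * _).
have : y k != 0 by rewrite expf_neq0.
by move: (y k) => z z0; field; rewrite z0 oner_neq0.
Qed.

Lemma qpochD a z i j :
  qpoch a z (i + j) = qpoch a z i * qpoch (a * z ^+ i) z j.
Proof.
rewrite /qpoch big_split_ord /=; congr (_ * _).
by apply: eq_bigr => k _; rewrite exprD mulrA.
Qed.

(* The factors of [alphaq] that remain defined when [p] is a root of unity and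
   [y] is transcendental. *)
Definition gammaq p y (k : nat) : F :=
  p ^- (4 * k) * qint p (8 * k + 1) ^+ 2 * qint (p ^+ 2) (8 * k + 1)
  * (qpoch (y * p ^+ 2) (p ^+ 8) k / qpoch (y * p ^+ 8) (p ^+ 8) k
     * (qpoch (p ^+ 2 / y) (p ^+ 8) k / qpoch (p ^+ 8 / y) (p ^+ 8) k)).

Lemma alphaqE p y k : alphaq p y k
  = gammaq p y k * (qpoch (p ^+ 2) (p ^+ 8) k / qpoch (p ^+ 8) (p ^+ 8) k) ^+ 2.
Proof.
rewrite /alphaq /gammaq !expr2 -[RHS]mulrA; congr (_ * _).
move: (qpoch _ _ _) (qpoch _ _ _) (qpoch _ _ _) (qpoch _ _ _) (qpoch _ _ _) (qpoch _ _ _).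
by move=> *; rewrite !invfM; ring.
Qed.

End WellPoised.

(** * Specialization of rational functions *)

Section Evaluation.
Variables (A : idomainType) (K : fieldType) (phi : {rmorphism A -> K}).
Implicit Types (f g : {fraction A}) (v w : K).

(* [f] lies in the local ring of the kernel of [phi] and has residue [v] there. *)
Definition evals f v :=
  exists a b, [/\ f = tofrac a / tofrac b, phi b != 0 & phi a = v * phi b].

Lemma rmorph_neq0 b : phi b != 0 -> b != 0.
Proof. by apply: contraNneq => ->; rewrite rmorph0. Qed.

Lemma evals_tofrac a : evals (tofrac a) (phi a).
Proof. by exists a, 1; rewrite tofrac1 divr1 rmorph1 mulr1 oner_neq0. Qed.

Lemma evals1 : evals 1 1.
Proof. by have := evals_tofrac 1; rewrite tofrac1 rmorph1. Qed.

Lemma evals0 : evals 0 0.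
Proof. by have := evals_tofrac 0; rewrite tofrac0 rmorph0. Qed.

Lemma evalsM f g v w : evals f v -> evals g w -> evals (f * g) (v * w).
Proof.
move=> [a [b [-> nb E]]] [c [d [-> nd E']]]; exists (a * c), (b * d).
rewrite !tofracM !rmorphM mulf_neq0 // E E'; split => //; last by ring.
by rewrite invfM mulrACA.
Qed.

Lemma evalsD f g v w : evals f v -> evals g w -> evals (f + g) (v + w).
Proof.
move=> [a [b [-> nb E]]] [c [d [-> nd E']]]; exists (a * d + c * b), (b * d).
rewrite !(tofracM, tofracD) !rmorphD !rmorphM mulf_neq0 // E E'; split => //; last by ring.
by rewrite addf_div ?tofrac_eq0 ?rmorph_neq0.
Qed.

Lemma evalsN f v : evals f v -> evals (- f) (- v).
Proof.
move=> [a [b [-> nb E]]]; exists (- a), b.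
by rewrite tofracN rmorphN E !mulNr.
Qed.

Lemma evalsB f g v w : evals f v -> evals g w -> evals (f - g) (v - w).
Proof. by move=> ef eg; apply/evalsD/evalsN. Qed.

Lemma evalsV f v : v != 0 -> evals f v -> evals f^-1 v^-1.
Proof.
move=> nv [a [b [-> nb E]]]; exists b, a.
by rewrite invf_div E mulf_neq0 // mulKf.
Qed.

Lemma evals_div f g v w : w != 0 -> evals f v -> evals g w -> evals (f / g) (v / w).
Proof. by move=> nw ef eg; apply/evalsM/evalsV. Qed.

Lemma evalsX n f v : evals f v -> evals (f ^+ n) (v ^+ n).
Proof.
move=> ef; elim: n => [|n IH]; first exact: evals1.
by rewrite !exprS; apply: evalsM.
Qed.

Lemma evals_sum I (r : seq I) (f : I -> {fraction A}) (v : I -> K) :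
  (forall i, evals (f i) (v i)) -> evals (\sum_(i <- r) f i) (\sum_(i <- r) v i).
Proof.
by move=> efv; elim/big_rec2: _ => [|i w g _]; [apply: evals0 | apply: evalsD].
Qed.

Lemma evals_prod I (r : seq I) (P : pred I) (f : I -> {fraction A}) (v : I -> K) :
  (forall i, P i -> evals (f i) (v i)) ->
  evals (\prod_(i <- r | P i) f i) (\prod_(i <- r | P i) v i).
Proof.
move=> efv; elim/big_rec2: _ => [|i w g Pi]; first exact: evals1.
by apply: evalsM; apply: efv.
Qed.

End Evaluation.

(** * Lowest terms and kernels of the specializations *)

Lemma lowest_terms (f : ratfun) (a b : bipoly) :
  b != 0 -> f = tofrac a / tofrac b ->
  exists A1 A2 : bipoly, [/\ A2 != 0, f = tofrac A1 / tofrac A2 & rcoprime A1 A2].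
Proof.
(* The measure is, up to a constant, the degree in $x$ plus the degree in $q$ of the leading
   coefficient. Removing a nonunit common factor lowers it. *)
have [k] := ubnP (size b + size (lead_coef b)).
elim: k => // k IH in a b * => lek nb fE.
case: (Classical_Prop.classic (rcoprime a b)) => [cab | ncab]; first by exists a, b.
have [d [da [db nd]]] : exists d, rdivides d a /\ rdivides d b /\ ~ (d \is a GRing.unit).
  apply: Classical_Prop.NNPP => h; apply: ncab => d da db.
  by apply: Classical_Prop.NNPP => nd; apply: h; exists d.
case: da db => a' aE [b' bE].
have [d0 b0] : d != 0 /\ b' != 0.
  by move: nb; rewrite bE mulf_eq0 => /norP[].
apply: (IH a' b') => //; last first.
  by rewrite fE aE bE !tofracM -mulf_div divff ?mul1r // tofrac_eq0.
have ld0 : lead_coef d != 0 by rewrite lead_coef_eq0.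
have lb0 : lead_coef b' != 0 by rewrite lead_coef_eq0.
move: lek; rewrite bE lead_coefM !size_mul //.
move: (d0) (ld0) (b0) (lb0); rewrite -!size_poly_gt0.
(* If both sizes were 1, [d] would be a nonzero rational constant, hence a unit. *)
suff : (size d != 1) || (size (lead_coef d) != 1).
  by move: (size d) (size b') (size (lead_coef d)) (size (lead_coef b')); lia.
rewrite -negb_and; apply/negP => /andP[/size_poly1P[e e0 dE]].
rewrite dE lead_coefC => /size_poly1P[u u0 eE]; apply: nd.
by rewrite dE eE !poly_unitE !size_polyC !coefC /= size_polyC polyC_eq0 u0 unitfE.
Qed.

(** Cross-multiplying with a fraction whose denominator survives [phi] puts [A1] in the kernel. If
    [A2] were there too, [p] would divide both, hence be a unit, although [phi] sends it to 0. *)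
Lemma evals_lowest (K : fieldType) (phi : {rmorphism bipoly -> K}) (p : bipoly)
    (f : ratfun) (A1 A2 : bipoly) :
  phi p = 0 -> (forall b, phi b = 0 -> rdivides p b) ->
  A2 != 0 -> f = tofrac A1 / tofrac A2 -> rcoprime A1 A2 -> evals phi f 0 ->
  phi A1 = 0 /\ phi A2 != 0.
Proof.
move=> pp kp n2 fE cop [a [b [fE' nb]]]; rewrite mul0r => pa.
have E : A1 * b = a * A2.
  have nb' := rmorph_neq0 nb.
  apply/eqP; rewrite -tofrac_eq !tofracM -eqr_div ?tofrac_eq0 //.
  by rewrite -fE -fE'.
have p1 : phi A1 = 0.
  apply: (mulIf nb); rewrite -rmorphM E rmorphM pa !mul0r //.
split=> //; apply/negP => /eqP p2.
have up := cop p (kp _ p1) (kp _ p2).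
by have := rmorph_unit phi up; rewrite pp unitr0.
Qed.

Definition evalx (y : {fraction {poly rat}}) :
    {rmorphism bipoly -> {fraction {poly rat}}} :=
  GRing.RMorphism.clone _ _ (horner_eval y \o map_poly (@tofrac _)) _.

(** Only $q$ is specialized: $x$ stays an indeterminate, so the values are rational functions of $x$
    over [algC]. *)
Definition evalq (z : algC) : {rmorphism bipoly -> {fraction {poly algC}}} :=
  GRing.RMorphism.clone _ _
    (@tofrac _ \o map_poly (horner_eval z \o map_poly (ratr : rat -> algC))) _.

Arguments evalx : simpl never.
Arguments evalq : simpl never.

Lemma evalxE y b : evalx y b = (map_poly (@tofrac _) b).[y].
Proof. by []. Qed.

Lemma evalqE z b :
  evalq z b = tofrac (map_poly (horner_eval z \o map_poly ratr) b).
Proof. by []. Qed.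

Lemma rdivides_polyC (c : {poly rat}) (b : bipoly) :
  (forall i, c %| b`_i) -> rdivides (c%:P : bipoly) b.
Proof.
move=> cb; exists (\poly_(i < size b) (b`_i %/ c)).
apply/polyP => i; rewrite coefCM coef_poly; case: ltnP => [_ | szi].
  by rewrite mulrC divpK.
by rewrite mulr0 nth_default.
Qed.

Lemma evalq_eq0 z b :
  evalq z b = 0 -> forall i, root (map_poly ratr b`_i) z.
Proof.
move=> /eqP; rewrite evalqE tofrac_eq0 => /eqP/polyP h i.
by move: (h i); rewrite coef_map coef0 /= => /eqP.
Qed.

(** The generator is the minimal polynomial of [z] over the rationals, because all coefficients in
    $x$ of an element of the kernel vanish at [z]. *)
Lemma evalq_ker z : exists p : bipoly,
  evalq z p = 0 /\ forall b, evalq z b = 0 -> rdivides p b.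
Proof.
have [p [pE _] dvd_p] := minCpolyP z; exists p%:P; split.
  rewrite evalqE map_polyC /= /horner_eval -pE.
  by have /eqP -> := root_minCpoly z; rewrite tofrac0.
by move=> b /evalq_eq0 h; apply: rdivides_polyC => i; rewrite -dvd_p.
Qed.

Lemma evalx_ker (w : {poly rat}) b :
  evalx (tofrac w) b = 0 -> rdivides ('X - w%:P) b.
Proof.
rewrite evalxE horner_map => /eqP; rewrite tofrac_eq0 => /factor_theorem[g ->].
by exists g; rewrite mulrC.
Qed.

(** A factor theorem for a divisor with leading coefficient $-w$, in general not a unit. A power of
    $w$ is introduced in order to divide, then removed by $xw\equiv1$ modulo $1-xw$. *)
Lemma evalx_inv_ker (w : {poly rat}) b : w != 0 ->
  evalx (tofrac w)^-1 b = 0 -> rdivides (1 - 'X * w%:P) b.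
Proof.
move=> w0 eb; set p := 1 - _.
have [N [g [r E]]] : exists N g (r : {poly rat}), (w ^+ N)%:P * b = p * g + r%:P.
  elim/poly_ind: b {eb} => [|b c [N [g [r IH]]]].
    by exists 0%N, 0, 0; rewrite !mulr0 add0r.
  exists N.+1, ('X * w%:P * g - r%:P), (r + w ^+ N.+1 * c).
  transitivity ('X * w%:P * ((w ^+ N)%:P * b) + (w ^+ N.+1 * c)%:P).
    rewrite !rmorphM !rmorphXn /= exprS; ring.
  rewrite IH rmorphD /= /p; ring.
have p0 : evalx (tofrac w)^-1 p = 0.
  rewrite evalxE rmorphB rmorph1 rmorphM /= map_polyX map_polyC /= !hornerE.
  by rewrite mulVf ?subrr // tofrac_eq0.
have r0 : r = 0.
  have /(congr1 (evalx (tofrac w)^-1)) := E.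
  rewrite (rmorphM (evalx _)) eb mulr0 (rmorphD (evalx _)) (rmorphM (evalx _)) p0 mul0r add0r.
  rewrite evalxE map_polyC hornerC => /esym/eqP.
  by rewrite tofrac_eq0 => /eqP.
rewrite r0 addr0 in E.
(* From $b=(1-(xw)^N)b+x^N(w^Nb)$, where both summands are multiples of [p]. *)
exists (b * (\sum_(i < N) ('X * w%:P) ^+ i) + 'X^N * g).
rewrite mulrDr mulrCA.
have -> : p * \sum_(i < N) ('X * w%:P) ^+ i = 1 - ('X * w%:P) ^+ N.
  by rewrite -[RHS]opprB subrX1 -mulNr opprB.
rewrite [p * _]mulrCA -E exprMn rmorphXn /=; ring.
Qed.

Lemma evalxX y : evalx y 'X = y.
Proof. by rewrite evalxE map_polyX hornerX. Qed.

Lemma evalxC y c : evalx y (c%:P) = tofrac c.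
Proof. by rewrite evalxE map_polyC hornerC. Qed.

Lemma evalqX z : evalq z 'X = tofrac 'X.
Proof. by rewrite evalqE map_polyX. Qed.

Lemma evalqC z c : evalq z (c%:P) = tofrac ((map_poly ratr c).[z])%:P.
Proof. by rewrite evalqE map_polyC. Qed.

(** [evals_lowest] puts the numerator in every kernel and the denominator in none. The factors of
    the modulus can be split off one at a time, because $w^2\ne1$ separates the two zeros in $x$ and
    both factors in $x$ survive every specialization of $q$. The second hypothesis says that
    divisibility by [c] can be read off its roots, as for a squarefree polynomial. *)
Lemma ratcongr_of_evals (c w : {poly rat}) (U V : ratfun) :
    c != 0 ->
    (forall p : {poly rat},
       (forall z, root (map_poly ratr c) z -> root (map_poly (ratr : rat -> algC) p) z) ->
     c %| p) ->
    w != 0 -> w ^+ 2 != 1 ->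
    (forall z, root (map_poly ratr c) z -> evals (evalq z) (U - V) 0) ->
    evals (evalx (tofrac w)) (U - V) 0 -> evals (evalx (tofrac w)^-1) (U - V) 0 ->
  ratcongr U V (tofrac (c%:P * (1 - 'X * w%:P) * ('X - w%:P))).
Proof.
move=> c0 dvd_c w0 w1 ez ew ev.
have [a [b [abE nb _]]] := ew.
have [A1 [A2 [n2 fE cop]]] := lowest_terms (rmorph_neq0 nb) abE.
exists (c%:P * (1 - 'X * w%:P) * ('X - w%:P)), A1, A2.
set p2 := 'X - w%:P; set p3 := 1 - 'X * w%:P.
have tw0 : tofrac w != 0 by rewrite tofrac_eq0.
have e22 : evalx (tofrac w) p2 = 0.
  by rewrite (rmorphB (evalx _)) evalxX evalxC subrr.
have e33 : evalx (tofrac w)^-1 p3 = 0.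
  by rewrite (rmorphB (evalx _)) rmorph1 (rmorphM (evalx _)) evalxX evalxC mulVf ?subrr.
have e32 : evalx (tofrac w)^-1 p2 != 0.
  rewrite (rmorphB (evalx _)) evalxX evalxC; apply: contra w1 => /eqP h.
  rewrite -tofrac_eq tofracXn tofrac1 expr2; apply/eqP.
  by rewrite -{1}(subr0_eq h) mulVf.
have ezz z p : (p = p2) \/ (p = p3) -> evalq z p != 0.
  have nX (u v : algC) : u != 0 \/ v != 0 -> u%:P - 'X * v%:P != 0 :> {poly algC}.
    case=> n0; apply/eqP => /polyP h.
      by have := h 0%N; rewrite coefB coefC coefXM subr0 coef0 /= => /eqP; apply/negP.
    have := h 1%N; rewrite coefB coefC coefXM coefC coef0 /= sub0r => /eqP.
    by rewrite oppr_eq0; apply/negP.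
  case=> ->; rewrite (rmorphB (evalq _)) ?rmorph1 ?(rmorphM (evalq _)) evalqX evalqC.
    rewrite -tofracB tofrac_eq0 -opprB oppr_eq0 -{1}['X]mulr1 -polyC1 nX //.
    by right; rewrite oner_neq0.
  by rewrite -tofracM -tofrac1 -tofracB tofrac_eq0 -polyC1 nX //; left; rewrite oner_neq0.
have [A12 A22] := evals_lowest e22 (@evalx_ker w) n2 fE cop ew.
have [A13 A23] := evals_lowest e33 (fun b => evalx_inv_ker w0) n2 fE cop ev.
have zA z : root (map_poly ratr c) z -> evalq z A1 = 0 /\ evalq z A2 != 0.
  move=> cz; have [p [pz kp]] := evalq_ker z.
  exact: evals_lowest pz kp n2 fE cop (ez z cz).
split=> //.
  have [B BE] := evalx_ker A12.
  have : evalx (tofrac w)^-1 B = 0.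
    apply: (mulfI e32); rewrite -(rmorphM (evalx _)) -/p2 mulr0.
    by have := A13; rewrite BE.
  case/(evalx_inv_ker w0) => B' B'E.
  have [B'' B''E] : rdivides (c%:P : bipoly) B'.
    apply: rdivides_polyC => i; apply: dvd_c => z cz.
    apply: evalq_eq0; have [+ _] := zA z cz.
    rewrite BE B'E !(rmorphM (evalq _)) => /eqP.
    rewrite !mulf_eq0.
    have n2z : evalq z p2 != 0 by apply: ezz; left.
    have n3z : evalq z p3 != 0 by apply: ezz; right.
    by rewrite (negbTE n2z) (negbTE n3z) /= => /eqP.
  by exists B''; rewrite BE B'E B''E -/p2 -/p3; ring.
move=> d dP [g gE].
(* A common divisor of the modulus and [A2] lies in none of the kernels, so both factors in $x$
   divide its cofactor and can be cancelled until it divides [c]. *)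
have phid (K : fieldType) (phi : {rmorphism bipoly -> K}) : phi A2 != 0 -> phi d != 0.
  by rewrite gE rmorphM mulf_eq0 => /norP[].
have [h hE] := dP.
have : evalx (tofrac w) h = 0.
  apply: (mulfI (phid _ _ A22)); rewrite -(rmorphM (evalx _)) -hE rmorphM e22 !mulr0 //.
case/evalx_ker => h' h'E.
have p20 : p2 != 0 by apply: rmorph_neq0 e32.
have dP' : c%:P * p3 = d * h'.
  by apply: (mulIf p20); rewrite hE h'E -/p2; ring.
have : evalx (tofrac w)^-1 h' = 0.
  apply: (mulfI (phid _ _ A23)); rewrite -(rmorphM (evalx _)) -dP' rmorphM e33 !mulr0 //.
case/(evalx_inv_ker w0) => h'' h''E.
have p30 : p3 != 0 by apply: (rmorph_neq0 (phi := evalq 0)); apply: ezz; right.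
have dP'' : c%:P = d * h''.
  by apply: (mulIf p30); rewrite dP' h''E -/p3; ring.
have cP0 : (c%:P : bipoly) != 0 by rewrite polyC_eq0.
have [d0 h''0] : d != 0 /\ h'' != 0.
  by move: cP0; rewrite dP'' mulf_eq0 => /norP[].
have szd : size d = 1%N.
  have := size_polyC c; rewrite c0 dP'' size_mul //.
  by move: d0 h''0; rewrite -!size_poly_gt0; move: (size d) (size h'') => s1 s2; clear; lia.
have [u u0 dE] := size_poly1P _ (introT eqP szd).
(* Now [d] is a polynomial [u] in $q$ dividing [c]. A root of [u] would be a root of [c] at which
   [d] vanishes, so [u] is constant. *)
have [/size_poly1P[v v0 uE] | /closed_rootP[z]] :=
  boolP (size (map_poly (ratr : rat -> algC) u) == 1%N).
  have : size u == 1%N by rewrite -(size_map_poly (ratr : rat -> algC)) uE size_polyC v0.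
  move=> /size_poly1P[t t0 uE']; rewrite dE uE'.
  by rewrite !poly_unitE !size_polyC !coefC /= size_polyC polyC_eq0 t0 unitfE.
move=> uz; have : root (map_poly ratr c) z.
  have : c = u * h''`_0 by have := congr1 (fun p : bipoly => p`_0) dP''; rewrite coefC dE coefCM.
  by move=> ->; rewrite rmorphM rootM uz.
case/zA => _ /phid; rewrite dE evalqC (eqP uz) tofrac0 eqxx //.
Qed.

(** * The factor $[n]_{q^2}$ as a polynomial in $q$ *)

Definition qgeom n : {poly rat} := \sum_(i < n) 'X ^+ (2 * i).

Lemma qgeomE n : qgeom n * (1 - 'X ^+ 2) = 1 - 'X ^+ (2 * n).
Proof.
rewrite exprM /qgeom; under eq_bigr do rewrite exprM.
move: ('X ^+ 2) => y.
by rewrite -[RHS]opprB subrX1 -mulNr opprB mulrC.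
Qed.

Lemma qgeom_neq0 n : (0 < n)%N -> qgeom n != 0.
Proof.
move=> n0; apply/eqP => h; have := qgeomE n; rewrite h mul0r.
move=> /(congr1 (fun p : {poly rat} => p`_0)) /eqP.
rewrite coefB coefXn coef1 coef0; by case: n n0 {h}.
Qed.

(** As a divisor of $q^{2n}-1$ this polynomial has simple roots in [algC], so it divides whatever
    vanishes at them; divisibility over [algC] descends to the rationals. *)
Lemma qgeom_dvd n (p : {poly rat}) : (0 < n)%N ->
  (forall z, root (map_poly ratr (qgeom n)) z
     -> root (map_poly (ratr : rat -> algC) p) z) ->
  qgeom n %| p.
Proof.
move=> n0 h; rewrite -(dvdp_map (ratr : {rmorphism rat -> algC})).
set c := map_poly _ (qgeom n).
have c0 : c != 0 by rewrite map_poly_eq0 qgeom_neq0.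
have sep : separable_poly c.
  apply: (@dvdp_separable _ ('X^(2 * n) - 1)); last first.
    by apply: separable_Xn_sub_1; rewrite Num.Theory.pnatr_eq0; lia.
  apply/dvdpP; exists (- (1 - 'X^2)).
  rewrite mulNr mulrC -[LHS]opprB; congr (- _).
  have := congr1 (map_poly (ratr : rat -> algC)) (qgeomE n).
  by rewrite rmorphM !rmorphB !rmorph1 !rmorphXn /= !map_polyX => ->.
have [rs cE] := closed_field_poly_normal c.
have lc0 : lead_coef c != 0 by rewrite lead_coef_eq0.
rewrite [X in X %| _]cE dvdpZl //; apply: uniq_roots_dvdp.
  by apply/allP => z zrs; apply: h; rewrite -/c cE rootZ // root_prod_XsubC.
rewrite uniq_rootsE -separable_prod_XsubC.
by apply: dvdp_separable sep; rewrite [X in _ %| X]cE dvdpZr.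
Qed.

(** * Specialization of the series *)

Section EvalSeries.
Variables (A : idomainType) (K : fieldType) (phi : {rmorphism A -> K}).
Variables (q x : {fraction A}) (q0 x0 : K).
Hypotheses (eq_q : evals phi q q0) (eq_x : evals phi x x0).

Lemma evals_conv (a : nat -> {fraction A}) (b : nat -> K) k :
  (forall i, evals phi (a i) (b i)) ->
  [/\ evals phi (conv2 a k) (conv2 b k), evals phi (conv3 a k) (conv3 b k)
    & evals phi (conv4 a k) (conv4 b k)].
Proof.
by move=> ab; split; do ![apply: evals_sum => ? | apply: evalsM | apply: ab].
Qed.

Lemma evals_qpoch f z f0 z0 k : evals phi f f0 -> evals phi z z0 ->
  evals phi (qpoch f z k) (qpoch f0 z0 k).
Proof.
move=> ef ez; apply: evals_prod => i _; apply: evalsB; first exact: evals1.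
by apply/evalsM/evalsX.
Qed.

Lemma evals_qint z z0 k : evals phi z z0 -> z0 != 1 ->
  evals phi (qint z k) (qint z0 k).
Proof.
move=> ez z1; apply: evals_div; first by rewrite subr_eq0 eq_sym.
  by apply: evalsB; [exact: evals1 | exact: evalsX].
by apply: evalsB; first exact: evals1.
Qed.

Lemma evalsXz (z : int) : q0 != 0 -> evals phi (q ^ z) (q0 ^ z).
Proof.
by move=> nq; case: z => k; [| apply: evalsV; first rewrite expf_neq0 //]; apply: evalsX.
Qed.

Lemma evals_Efac : x0 != 0 -> q0 != 1 -> 1 + q0 ^+ 2 != 0 ->
  evals phi (Efac q x) (Efac q0 x0).
Proof.
move=> nx q1 q2.
have e1 := evals1 phi; have e2 := evalsX 2 eq_q.
apply: evalsB => //; apply: evals_div.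
- by rewrite mulf_neq0 ?expf_neq0 // subr_eq0 eq_sym.
- by apply: evalsM; apply: evalsB => //; [apply: evalsM | apply: evals_div].
- by apply: evalsM; [apply/evalsX/evalsB | apply: evalsD].
Qed.

Lemma evals_gammaq k : q0 != 0 -> x0 != 0 -> q0 != 1 -> q0 ^+ 2 != 1 ->
  (forall j, x0 * q0 ^+ j != 1) -> (forall j, q0 ^+ j / x0 != 1) ->
  evals phi (gammaq q x k) (gammaq q0 x0 k).
Proof.
move=> nq nx q1 q21 gx gx'.
have X i := evalsX i eq_q.
have nz1 : qpoch (x0 * q0 ^+ 8) (q0 ^+ 8) k != 0.
  by apply: qpoch_neq0 => j _; rewrite -exprM -mulrA -exprD.
have nz2 : qpoch (q0 ^+ 8 / x0) (q0 ^+ 8) k != 0.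
  by apply: qpoch_neq0 => j _; rewrite -exprM mulrAC -exprD.
have P f z f0 z0 := @evals_qpoch f z f0 z0 k.
apply: evalsM; [apply: evalsM; [apply: evalsM | ] | apply: evalsM].
- by apply: evalsV; rewrite ?expf_neq0.
- exact/evalsX/evals_qint.
- exact: evals_qint.
- by apply: evals_div => //; apply: P => //; apply: evalsM.
- by apply: evals_div => //; apply: P => //; apply: evals_div.
Qed.

Lemma evals_alphaq k : q0 != 0 -> x0 != 0 -> (forall j, q0 ^+ j.+1 != 1) ->
  (forall j, x0 * q0 ^+ (8 * j.+1) != 1) -> (forall j, q0 ^+ (8 * j.+1) / x0 != 1) ->
  evals phi (alphaq q x k) (alphaq q0 x0 k).
Proof.
move=> nq nx q1 gx gx'.
have X i := evalsX i eq_q.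
have nz1 : qpoch (x0 * q0 ^+ 8) (q0 ^+ 8) k != 0.
  by apply: qpoch_neq0 => j _; rewrite -exprM -mulrA -exprD -mulnS.
have nz2 : qpoch (q0 ^+ 8 / x0) (q0 ^+ 8) k != 0.
  by apply: qpoch_neq0 => j _; rewrite -exprM mulrAC -exprD -mulnS.
have nz3 : qpoch (q0 ^+ 8) (q0 ^+ 8) k != 0.
  by apply: qpoch_neq0 => j _; rewrite -exprS -exprM mulnS (q1 (7 + 8 * j)%N).
have q11 := q1 0%N.
have P f z f0 z0 := @evals_qpoch f z f0 z0 k.
have P1 : evals phi (qpoch (x * q ^+ 2) (q ^+ 8) k) (qpoch (x0 * q0 ^+ 2) (q0 ^+ 8) k).
  by apply: P => //; apply: evalsM.
have P2 : evals phi (qpoch (x * q ^+ 8) (q ^+ 8) k) (qpoch (x0 * q0 ^+ 8) (q0 ^+ 8) k).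
  by apply: P => //; apply: evalsM.
have P3 : evals phi (qpoch (q ^+ 2 / x) (q ^+ 8) k) (qpoch (q0 ^+ 2 / x0) (q0 ^+ 8) k).
  by apply: P => //; apply: evals_div.
have P4 : evals phi (qpoch (q ^+ 8 / x) (q ^+ 8) k) (qpoch (q0 ^+ 8 / x0) (q0 ^+ 8) k).
  by apply: P => //; apply: evals_div.
have P5 : evals phi (qpoch (q ^+ 2) (q ^+ 8) k) (qpoch (q0 ^+ 2) (q0 ^+ 8) k) by apply: P.
have P6 : evals phi (qpoch (q ^+ 8) (q ^+ 8) k) (qpoch (q0 ^+ 8) (q0 ^+ 8) k) by apply: P.
have q12 := q1 1%N.
apply: evalsM; [apply: evalsM; [apply: evalsM | ] | apply: evals_div].
- by apply: evalsV; rewrite ?expf_neq0.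
- exact/evalsX/evals_qint.
- exact: evals_qint.
- by rewrite !mulf_neq0 ?expf_neq0.
- by apply: evalsM => //; apply: evalsM => //; apply: evalsX.
- by apply: evalsM => //; apply: evalsM => //; apply: evalsX.
Qed.

End EvalSeries.

(** * Residues at a root of unity *)

Section RootOfUnity.
Variables (A : idomainType) (K : fieldType) (phi : {rmorphism A -> K}).
Variables (q x : {fraction A}) (q0 x0 : K) (d : nat).
Hypotheses (eq_q : evals phi q q0) (eq_x : evals phi x x0).
Hypotheses (d_gt1 : (1 < d)%N) (d_mod4 : (d %% 4 = 1)%N).
Hypothesis q0_order : forall i, (q0 ^+ (2 * i) == 1) = (d %| i)%N.
Hypothesis q_order : q ^+ (2 * d) != 1.
Hypothesis K_char : forall i, i.+1%:R != 0 :> K.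

Let q0_neq0 : q0 != 0.
Proof.
apply/eqP => q00; have := q0_order d.
by rewrite dvdnn q00 expr0n muln_eq0 /= (gtn_eqF (ltnW d_gt1)) eq_sym oner_eq0.
Qed.

Let evals_geom s : evals phi (\sum_(i < s) q ^+ (2 * d * i)) (s%:R).
Proof.
have -> : s%:R = \sum_(i < s) q0 ^+ (2 * d * i).
  rewrite -[in LHS](card_ord s) -sumr_const; apply: eq_bigr => i _.
  by apply/esym/eqP; rewrite -mulnA q0_order dvdn_mulr.
by apply: evals_sum => i; apply: evalsX.
Qed.

Let geomE s : 1 - q ^+ (2 * (d * s)) = (1 - q ^+ (2 * d)) * \sum_(i < s) q ^+ (2 * d * i).
Proof.
rewrite mulnA exprM; under eq_bigr do rewrite exprM.
by rewrite -[LHS]opprB subrX1 -mulNr opprB.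
Qed.

Let q8_neq1 j : (j.+1 < d)%N -> q0 ^+ (8 * j.+1) != 1.
Proof.
move=> ljd; rewrite -(mulnA 2 4) q0_order Gauss_dvdr; last first.
  have dodd : odd d by rewrite (divn_eq d 4) d_mod4 oddD oddM andbF.
  by rewrite (coprimeMr d 2 2) !coprimen2 dodd.
by rewrite gtnNdvd.
Qed.

Let q8_unity l : q0 ^+ (8 * (l * d)) = 1.
Proof. by apply/eqP; rewrite -(mulnA 2 4) q0_order !dvdn_mull. Qed.

(* Over one period of length [d], numerator and denominator each contain exactly
   one factor vanishing at [q0], so their quotient is still defined there. *)
Lemma evals_qpoch_ratio c j0 u :
    (j0 < d)%N -> (c + 4 * j0 = d * u)%N ->
  exists h : nat -> K, forall l k, (k < d)%N ->
    evals phi (qpoch (q ^+ (2 * c)) (q ^+ 8) (l * d + k) / qpoch (q ^+ 8) (q ^+ 8) (l * d + k))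
      (h l * (qpoch (q0 ^+ (2 * c)) (q0 ^+ 8) k / qpoch (q0 ^+ 8) (q0 ^+ 8) k)).
Proof.
move=> lj0 cE.
pose beta k := qpoch (q ^+ (2 * c)) (q ^+ 8) k / qpoch (q ^+ 8) (q ^+ 8) k.
have betaD i k : beta (i + k)%N = beta i *
    (qpoch (q ^+ (2 * c) * q ^+ 8 ^+ i) (q ^+ 8) k / qpoch (q ^+ 8 * q ^+ 8 ^+ i) (q ^+ 8) k).
  by rewrite /beta !qpochD mulf_div.
have evalsQ e l : evals phi (q ^+ e * q ^+ 8 ^+ (l * d)) (q0 ^+ e).
  rewrite -[X in evals _ _ X]mulr1 -(q8_unity l) -exprM.
  by apply: evalsM; apply: evalsX.
have nz k : (k < d)%N -> qpoch (q0 ^+ 8) (q0 ^+ 8) k != 0.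
  move=> lkd; apply: qpoch_neq0 => j ljk; rewrite -exprS -exprM q8_neq1 //.
  exact: leq_ltn_trans ljk lkd.
have d1 : (d.-1 < d)%N by case: (d) d_gt1.
pose N := \prod_(j < d | j != Ordinal lj0) (1 - q0 ^+ (2 * c) * q0 ^+ 8 ^+ j).
pose D := \prod_(j < d | j != Ordinal d1) (1 - q0 ^+ 8 * q0 ^+ 8 ^+ j).
have D0 : D != 0.
  apply/prodf_neq0 => j nj; rewrite -exprS -exprM subr_eq0 eq_sym q8_neq1 //.
  have : (j != d.-1 :> nat) by apply: contra nj => /eqP h; apply/eqP/val_inj.
  by move: (nat_of_ord j) (ltn_ord j) => i; clear -d_gt1; lia.
(* Residue of the block of indices from $ld$ to $ld+d-1$. Its vanishing factors are $1-q^{2d(u+4l)}$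
   and $1-q^{8d(l+1)}$; division by $1-q^{2d}$ leaves geometric sums with values $u+4l$ and
   $4(l+1)$. *)
pose r l := (N * (u + 4 * l)%:R) / (D * (4 * l.+1)%:R).
have er l : evals phi
    (qpoch (q ^+ (2 * c) * q ^+ 8 ^+ (l * d)) (q ^+ 8) d
     / qpoch (q ^+ 8 * q ^+ 8 ^+ (l * d)) (q ^+ 8) d) (r l).
  rewrite /qpoch (bigD1 (Ordinal lj0)) // [X in _ / X](bigD1 (Ordinal d1)) //=.
  have -> : 1 - q ^+ (2 * c) * q ^+ 8 ^+ (l * d) * q ^+ 8 ^+ j0
      = (1 - q ^+ (2 * d)) * \sum_(i < u + 4 * l) q ^+ (2 * d * i).
    rewrite -geomE -!exprM -!exprD; congr (1 - q ^+ _).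
    by rewrite mulnDr -cE; clear; lia.
  have -> : 1 - q ^+ 8 * q ^+ 8 ^+ (l * d) * q ^+ 8 ^+ d.-1
      = (1 - q ^+ (2 * d)) * \sum_(i < 4 * l.+1) q ^+ (2 * d * i).
    rewrite -geomE -!exprM -!exprD; congr (1 - q ^+ _).
    by move: d_gt1; clear; case: (d) => // n _ /=; lia.
  have nq : 1 - q ^+ (2 * d) != 0 by rewrite subr_eq0 eq_sym.
  rewrite -![_ * _ * \prod_(_ < _ | _) _]mulrA -mulf_div divff // mul1r /r.
  apply: evals_div.
  - by rewrite mulf_neq0 // mulnS (K_char (3 + 4 * l)).
  - rewrite mulrC; apply: evalsM => //; apply: evals_prod => i _.
    by apply: evalsB; [exact: evals1 | apply: evalsM => //; do 2!apply: evalsX].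
  - rewrite mulrC; apply: evalsM => //; apply: evals_prod => i _.
    by apply: evalsB; [exact: evals1 | apply: evalsM => //; do 2!apply: evalsX].
exists (fun l => \prod_(i < l) r i) => l k lkd; rewrite -/(beta _) betaD.
apply: evalsM.
  elim: l => [|l IH]; first by rewrite /beta !qpoch0 divr1 big_ord0; apply: evals1.
  by rewrite mulSnr betaD big_ord_recr; apply: evalsM.
apply: evals_div; first exact: nz.
  by apply: evals_qpoch => //; apply: evalsX.
by apply: evals_qpoch => //; apply: evalsX.
Qed.

Hypothesis x0_neq0 : x0 != 0.
Hypothesis x0_gen : forall i, x0 * q0 ^+ i != 1.
Hypothesis x0_gen' : forall i, q0 ^+ i / x0 != 1.

Let q0_neq1 : q0 != 1.
Proof.
apply/eqP => q01; have := q0_order 1; rewrite q01 expr1n eqxx dvdn1 => /esym/eqP d1.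
by move: d_gt1; rewrite d1.
Qed.

Let q02_neq1 : q0 ^+ 2 != 1.
Proof. by rewrite (q0_order 1) dvdn1; case: d d_gt1 => [|[]]. Qed.

(** The factor of index $(d-1)/4$ in $(q^2;q^8)_k$ is $1-q^{2d}$, which vanishes at [q0]. *)
Let alphaq_root_eq0 k : (d <= 4 * k)%N -> alphaq q0 x0 k = 0.
Proof.
pose m := (d %/ 4)%N.
have dE : (4 * m + 1 = d)%N by rewrite [RHS](divn_eq d 4) d_mod4 mulnC.
move=> ldk; have lmk : (m < k)%N by clear -ldk dE; lia.
rewrite alphaqE.
suff -> : qpoch (q0 ^+ 2) (q0 ^+ 8) k = 0 by rewrite mul0r expr0n mulr0.
apply/eqP/prodf_eq0; exists (Ordinal lmk) => //=.
have -> : q0 ^+ 2 * q0 ^+ 8 ^+ m = q0 ^+ (2 * d).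
  by rewrite -exprM -exprD -dE; congr (q0 ^+ _); clear; lia.
by rewrite subr_eq0 eq_sym q0_order dvdnn.
Qed.

Lemma alphaq_root_sum : \sum_(k < d) alphaq q0 x0 k = 0.
Proof.
pose m := (d %/ 4)%N.
have dE : (4 * m + 1 = d)%N by rewrite [RHS](divn_eq d 4) d_mod4 mulnC.
have lmd : (m < d)%N by rewrite -dE; clear; lia.
have van k : (m < k)%N -> alphaq q0 x0 k = 0.
  by move=> lmk; apply: alphaq_root_eq0; clear -lmk dE; lia.
have -> : \sum_(k < d) alphaq q0 x0 k = \sum_(k < m.+1) alphaq q0 x0 k.
  rewrite (big_ord_widen _ (alphaq q0 x0) lmd) [RHS]big_mkcond; apply: eq_bigr => k _ /=.
  by rewrite ltnS; case: leqP => // /van.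
set S := \sum_(k < m.+1) _.
have SN : S = - S.
  rewrite {1}/S (reindex_inj rev_ord_inj) /= -sumrN; apply: eq_bigr => k _.
  rewrite subSS; apply: alphaq_antisym => //.
  - apply/eqP; rewrite (_ : (8 * m + 2 = 2 * d)%N); last by rewrite -dE; clear; lia.
    by rewrite q0_order dvdnn.
  - by move=> j ljm; apply: q8_neq1; apply: leq_ltn_trans ljm lmd.
  - by rewrite -ltnS.
have /eqP := SN; rewrite -subr_eq0 opprK -mulr2n -mulr_natl mulf_eq0.
by rewrite (negbTE (K_char 1)) => /eqP.
Qed.

(** From index $d$ on, $(q^8;q^8)_i$ vanishes at [q0], so [alphaq q0 x0 i] need not be the residue
    of [alphaq q x i]. The residue at $i=ld+k$ is [c l * alphaq q0 x0 k], and [sum_conv] brings out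
    a power of the vanishing sum over one period. *)
Lemma evals_conv_root n' (n := (n' * d)%N) :
  [/\ evals phi (\sum_(k < n) conv2 (alphaq q x) k) 0,
      evals phi (\sum_(k < n) conv3 (alphaq q x) k) 0
    & evals phi (\sum_(k < n) conv4 (alphaq q x) k) 0].
Proof.
pose m := (d %/ 4)%N.
have dE : (4 * m + 1 = d)%N by rewrite [RHS](divn_eq d 4) d_mod4 mulnC.
have lmd : (m < d)%N by rewrite -dE; clear; lia.
have d0 : (0 < d)%N by apply: ltn_trans d_gt1.
(* In $(q^2;q^8)$ the vanishing factor of the first period has index $m$, since $1+4m=d$. *)
have [h eh] := @evals_qpoch_ratio 1 m 1 lmd (etrans (addnC _ _) (etrans dE (esym (muln1 d)))).
pose rho l := qpoch (x0 * q0 ^+ 2) (q0 ^+ 8) (l * d) / qpoch (x0 * q0 ^+ 8) (q0 ^+ 8) (l * d)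
     * (qpoch (q0 ^+ 2 / x0) (q0 ^+ 8) (l * d) / qpoch (q0 ^+ 8 / x0) (q0 ^+ 8) (l * d)).
have gammaD l k : gammaq q0 x0 (l * d + k) = rho l * gammaq q0 x0 k.
  have Q1 : q0 ^+ 8 ^+ (l * d) = 1 by rewrite -exprM.
  rewrite /gammaq /rho !qpochD !Q1 !mulr1.
  have -> : q0 ^- (4 * (l * d + k)) = q0 ^- (4 * k).
    rewrite mulnDr exprD (_ : q0 ^+ (4 * (l * d)) = 1) ?mul1r //.
    by apply/eqP; rewrite -(mulnA 2 2) q0_order !dvdn_mull.
  have -> : qint q0 (8 * (l * d + k) + 1) = qint q0 (8 * k + 1).
    by rewrite /qint mulnDr -addnA exprD q8_unity mul1r.
  have -> : qint (q0 ^+ 2) (8 * (l * d + k) + 1) = qint (q0 ^+ 2) (8 * k + 1).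
    rewrite /qint mulnDr -addnA exprD (_ : q0 ^+ 2 ^+ (8 * (l * d)) = 1) ?mul1r //.
    by rewrite -exprM mulnC exprM q8_unity expr1n.
  move: (qpoch _ _ _) (qpoch _ _ _) (qpoch _ _ _) (qpoch _ _ _).
  move: (qpoch _ _ _) (qpoch _ _ _) (qpoch _ _ _) (qpoch _ _ _) => *.
  by rewrite !invfM; ring.
pose c l := h l ^+ 2 * rho l.
pose a i := c (i %/ d)%N * alphaq q0 x0 (i %% d)%N.
have aE l k : (k < d)%N -> a (l * d + k)%N = c l * alphaq q0 x0 k.
  by move=> lkd; rewrite /a divnMDl // modnMDl divn_small // modn_small // addn0.
have ea i : evals phi (alphaq q x i) (a i).
  rewrite {1}(divn_eq i d) /a; have := ltn_pmod i d0.
  move: (i %/ d)%N (i %% d)%N => l k lkd.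
  rewrite !alphaqE /c.
  have -> : h l ^+ 2 * rho l * (gammaq q0 x0 k
      * (qpoch (q0 ^+ 2) (q0 ^+ 8) k / qpoch (q0 ^+ 8) (q0 ^+ 8) k) ^+ 2)
    = gammaq q0 x0 (l * d + k) *
      (h l * (qpoch (q0 ^+ 2) (q0 ^+ 8) k / qpoch (q0 ^+ 8) (q0 ^+ 8) k)) ^+ 2.
    by rewrite gammaD exprMn; ring.
  apply: evalsM; first exact: evals_gammaq.
  by apply: evalsX; apply: eh.
have [s2 s3 s4] := sum_conv d0 (fun l k (_ : (l < n')%N) lkd => aE l k lkd)
  (fun k _ => @alphaq_root_eq0 k).
rewrite alphaq_root_sum !expr0n !mulr0 in s2 s3 s4.
split; [rewrite -s2 | rewrite -s3 | rewrite -s4]; apply: evals_sum => k;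
  by have [] := evals_conv k ea.
Qed.

End RootOfUnity.

(** * Both sides of the congruences at the zeros of the modulus *)

Lemma modn4_primes n : (0 < n)%N ->
  (forall p, prime p -> (p %| n)%N -> (p %% 4 = 1)%N) -> (n %% 4 = 1)%N.
Proof.
have [k] := ubnP n; elim: k n => // k IH n lenk n0 hp.
have [-> // | n1] := eqVneq n 1%N.
have lt1n : (1 < n)%N by move: n0 n1; clear; lia.
have pr := pdiv_prime lt1n; have dv := pdiv_dvd n.
rewrite -(divnK dv) -modnMm (hp _ pr dv) muln1 modn_mod.
have q0 : (0 < n %/ pdiv n)%N by rewrite divn_gt0 ?pdiv_gt0 // dvdn_leq.
apply: IH => // [|p prp pn].
  by apply: leq_trans (ltn_Pdiv (prime_gt1 pr) n0) _.
by apply: hp => //; rewrite -[n](divnK dv) dvdn_mulr.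
Qed.

(** This is [sum_conv] with one block of length $n$: $\alpha(k)$ vanishes for $k>m$, hence whenever
    $n\le4k$. *)
Lemma sum_conv_alphaq (F : fieldType) (q : F) m (n := (4 * m + 1)%N) (x := q ^- (2 * n))
    (S := qint (q ^+ 2) n * (qpoch (q ^+ 4) (q ^+ 8) m / qpoch (q ^+ 8) (q ^+ 8) m)
       * q ^- (2 * m) * Efac q x) :
  q != 0 -> (forall j, q ^+ j.+1 != 1) ->
  [/\ \sum_(k < n) conv2 (alphaq q x) k = S ^+ 2,
      \sum_(k < n) conv3 (alphaq q x) k = S ^+ 3
    & \sum_(k < n) conv4 (alphaq q x) k = S ^+ 4].
Proof.
move=> q0 hq.
have van k : (m < k)%N -> alphaq q x k = 0 by apply: alphaq_eq0.
have lmn : (m < n)%N by rewrite /n; clear; lia.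
have ha l k : (l < 1)%N -> (k < n)%N ->
    alphaq q x (l * n + k) = (fun _ => 1) l * alphaq q x k.
  by case: l => // _ _; rewrite mul0n mul1r.
have hb k : (k < n)%N -> (n <= 4 * k)%N -> alphaq q x k = 0.
  by move=> _ h; apply: van; move: h; rewrite /n; clear; lia.
have [] := sum_conv (leq_ltn_trans (leq0n m) lmn) ha hb.
have -> : \sum_(k < n) alphaq q x k = S.
  rewrite /S -alphaq_sum // (big_ord_widen _ (alphaq q x) lmn) [RHS]big_mkcond.
  by apply: eq_bigr => k _ /=; rewrite ltnS; case: leqP => // /van.
rewrite mul1n !big_ord1 /conv2 /conv3 /conv4 !big_ord1 !mul1r.
by move=> -> -> ->.
Qed.

(** The powers are regrouped as $(N/D)^r$, because [D] alone may specialize to 0 at a root of unity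
    while [N / D] keeps a finite value. *)
Lemma evals_target (A : idomainType) (K : fieldType) (phi : {rmorphism A -> K})
    (f g h e : {fraction A}) (f0 g0 h0 e0 : K) (r : nat) (N D : {fraction A}) :
  g = N / D ->
  evals phi f f0 -> evals phi g g0 -> evals phi h h0 -> evals phi e e0 ->
  evals phi (f ^+ r * (N ^+ r / D ^+ r) * h * e ^+ r) (f0 ^+ r * g0 ^+ r * h0 * e0 ^+ r).
Proof.
move=> gE ef eg eh ee; rewrite -expr_div_n -gE.
by do ![apply: evalsX => // | apply: evalsM => //].
Qed.

Lemma exprz_target (F : fieldType) (q : F) m (n := (4 * m + 1)%N) : q != 0 ->
  [/\ q ^ (1 - n%:Z) = (q ^- (2 * m)) ^+ 2,
      q ^ (3 * (1 - n%:Z) %/ 2)%Z = (q ^- (2 * m)) ^+ 3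
    & q ^ (2 * (1 - n%:Z)) = (q ^- (2 * m)) ^+ 4].
Proof.
move=> q0.
(* The integer division is exact, since $1-n=-4m$. *)
have -> : (3 * (1 - n%:Z) %/ 2)%Z = - (2 * m * 3)%N%:Z.
  rewrite (_ : 3 * (1 - n%:Z) = - (2 * m * 3)%N%:Z * 2) ?mulzK //.
  by rewrite /n; clear; lia.
have -> : 1 - n%:Z = - (2 * m * 2)%N%:Z by rewrite /n; clear; lia.
have -> : 2 * (- (2 * m * 2)%N%:Z) = - (2 * m * 4)%N%:Z by clear; lia.
by split; rewrite -exprnN exprVn -exprM.
Qed.

Lemma qvX_neq1 j : qv ^+ j.+1 != 1.
Proof.
rewrite /qv -tofracXn -tofrac1 tofrac_eq -rmorphXn -polyC1.
apply/eqP => /polyC_inj /polyP /(_ 0%N) /eqP.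
by rewrite coefXn coef1 /= eq_sym oner_eq0.
Qed.

(** With $d$ the order of $z^2$, a divisor of $n$, the sums run over $n/d$ full periods. In the
    closed forms $[n]_{q^2}$ specializes to 0 and every other factor has a finite value. *)
Lemma evals_at_root n (z : algC) (m := ((n - 1) %/ 4)%N) : (0 < n)%N ->
    (forall p, prime p -> (p %| n)%N -> (p %% 4 = 1)%N) ->
    root (map_poly ratr (qgeom n)) z ->
  [/\ evals (evalq z) (\sum_(k < n) sq qv xv k) 0,
      evals (evalq z) (\sum_(k < n) tq qv xv k) 0,
      evals (evalq z) (\sum_(k < n) uq qv xv k) 0
    & forall r e, (0 < r)%N -> evals (evalq z)
        (qint (qv ^+ 2) n ^+ r
         * (qpoch (qv ^+ 4) (qv ^+ 8) m ^+ r / qpoch (qv ^+ 8) (qv ^+ 8) m ^+ r)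
         * qv ^ e * Efac qv xv ^+ r) 0].
Proof.
move=> n_gt0 n_primes cz.
have sumz : \sum_(i < n) z ^+ (2 * i) = 0.
  rewrite -[RHS](rootP cz) /qgeom rmorph_sum /= horner_sum.
  by apply: eq_bigr => i _; rewrite map_polyXn hornerXn.
have zn : (z ^+ 2) ^+ n = 1.
  have : (map_poly (ratr : rat -> algC) (qgeom n * (1 - 'X^2))).[z]
      = (map_poly (ratr : rat -> algC) (1 - 'X^(2 * n))).[z] by rewrite qgeomE.
  rewrite rmorphM hornerM (rootP cz) mul0r [map_poly _ (1 - _)]rmorphB rmorph1 /= map_polyXn.
  by rewrite hornerD hornerN hornerC hornerXn -exprM => /esym/subr0_eq.
(* If $z^2=1$, the vanishing sum [sumz] would be $n\ne0$. *)
have z1 : z ^+ 2 != 1.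
  apply: contraL n_gt0 => /eqP z1; rewrite -leqNgt leqn0.
  rewrite -(Num.Theory.pnatr_eq0 algC) -sumz -[n in n%:R]card_ord -sumr_const.
  by apply/eqP/eq_bigr => i _; rewrite exprM z1 expr1n.
have [d pd dn] := prim_order_exists n_gt0 zn.
have d0 := prim_order_gt0 pd.
have d4 : (d %% 4 = 1)%N.
  by apply: modn4_primes => // p prp pd'; apply: n_primes => //; apply: dvdn_trans pd' dn.
have d1 : (1 < d)%N.
  rewrite ltn_neqAle d0 andbT; apply: contra z1 => /eqP d1.
  by rewrite -d1 in pd; rewrite -[z ^+ 2]expr1 (prim_expr_order pd).
pose q0 : {fraction {poly algC}} := tofrac z%:P.
pose x0 : {fraction {poly algC}} := tofrac 'X.
have eq_q : evals (evalq z) qv q0.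
  have := evals_tofrac (evalq z) ('X%:P : bipoly).
  by rewrite evalqC map_polyX hornerX.
have eq_x : evals (evalq z) xv x0.
  by have := evals_tofrac (evalq z) ('X : bipoly); rewrite evalqX.
have q0X i : q0 ^+ i = tofrac (z ^+ i)%:P by rewrite -tofracXn -polyC_exp.
have q0_order i : (q0 ^+ (2 * i) == 1) = (d %| i)%N.
  by rewrite q0X -tofrac1 tofrac_eq -polyC1 (inj_eq (@polyC_inj _)) exprM (prim_order_dvd pd).
have nz_char i : i.+1%:R != 0 :> {fraction {poly algC}}.
  by rewrite -(rmorph_nat (@tofrac _)) tofrac_eq0 -(rmorph_nat (@polyC _)) polyC_eq0
    Num.Theory.pnatr_eq0.
have x0_neq0 : x0 != 0 by rewrite tofrac_eq0 polyX_eq0.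
have x0_gen i : x0 * q0 ^+ i != 1.
  rewrite q0X -tofracM -tofrac1 tofrac_eq; apply/eqP => /polyP/(_ 0%N)/eqP.
  by rewrite coefXM coef1 eq_sym oner_eq0.
have x0_gen' i : q0 ^+ i / x0 != 1.
  apply/eqP => /(congr1 (fun f => f * x0)); rewrite divfK // mul1r q0X => /eqP.
  rewrite tofrac_eq => /eqP/polyP/(_ 1%N)/eqP.
  by rewrite coefC coefX /= eq_sym oner_eq0.
have q_order : qv ^+ (2 * d) != 1.
  by case: (d) d0 => // d' _; rewrite mulnS qvX_neq1.
have [s2 s3 s4] := evals_conv_root eq_q eq_x d1 d4 q0_order q_order nz_char
  x0_neq0 x0_gen x0_gen' (n %/ d).
rewrite divnK // in s2 s3 s4; split=> // r e r0.
have dE : d = (4 * (d %/ 4) + 1)%N by rewrite {1}(divn_eq d 4) d4 mulnC.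
(* In $(q^4;q^8)$ the vanishing factor of the first period has index $(d-1)/2$ and is $1-q^{4d}$. *)
have lj0 : (2 * (d %/ 4) < d)%N by rewrite {2}dE; clear; lia.
have cE : (2 + 4 * (2 * (d %/ 4)) = d * 2)%N by rewrite {2}dE; clear; lia.
have [h eh] := evals_qpoch_ratio eq_q d1 d4 q0_order q_order nz_char lj0 cE.
have [v ev] : exists v, evals (evalq z)
    (qpoch (qv ^+ 4) (qv ^+ 8) m / qpoch (qv ^+ 8) (qv ^+ 8) m) v.
  by rewrite (divn_eq m d); eexists; apply: eh; apply: ltn_pmod.
have q02 : q0 ^+ 2 != 1 by rewrite q0X -tofrac1 tofrac_eq -polyC1 (inj_eq (@polyC_inj _)).
have q01 : q0 != 1 by apply: contra q02 => /eqP ->; rewrite expr1n.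
have q0_neq0 : q0 != 0.
  rewrite tofrac_eq0 polyC_eq0; apply/eqP => z0; move: zn (oner_neq0 algC).
  by rewrite z0 expr0n /= expr0n (gtn_eqF n_gt0) => <-; rewrite eqxx.
(* Otherwise [q0 ^+ 4 = 1], so $d$ divides 2, against $d>1$ and $d\equiv1$ modulo 4. *)
have q03 : 1 + q0 ^+ 2 != 0.
  apply/negP => /eqP h0; have := q0_order 2.
  have -> : q0 ^+ (2 * 2) = 1 by rewrite exprM -[q0 ^+ 2](addKr 1) h0; ring.
  rewrite eqxx => /esym/(dvdn_leq (isT : 0 < 2)%N).
  by move: d1 d4; clear; lia.
have eg : evals (evalq z) (qint (qv ^+ 2) n) 0.
  have := evals_qint n (evalsX 2 eq_q) q02.
  have -> : qint (q0 ^+ 2) n = 0.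
    have /eqP q1 : q0 ^+ (2 * n) == 1 by rewrite q0_order.
    by rewrite /qint -exprM q1 subrr mul0r.
  by [].
have := evals_target r (erefl _) eg ev (evalsXz eq_q e q0_neq0)
  (evals_Efac eq_q eq_x x0_neq0 q01 q03).
by rewrite expr0n (gtn_eqF r0) !mul0r.
Qed.

(** By the symmetry $x\mapsto1/x$ the closed form at $x=q^{-2n}$ serves both choices of [y]. Each
    sum and its closed form then specialize to the same power of [S]. *)
Lemma evals_at_power n (w := 'X^(2 * n) : {poly rat}) (m := ((n - 1) %/ 4)%N) y :
    (n %% 4 = 1)%N -> y = tofrac w \/ y = (tofrac w)^-1 ->
  exists S, forall r e,
    [/\ evals (evalx y) (\sum_(k < n) sq qv xv k) (S ^+ 2),
        evals (evalx y) (\sum_(k < n) tq qv xv k) (S ^+ 3),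
        evals (evalx y) (\sum_(k < n) uq qv xv k) (S ^+ 4)
      & qv ^ e = (qv ^- (2 * m)) ^+ r -> evals (evalx y)
        (qint (qv ^+ 2) n ^+ r
         * (qpoch (qv ^+ 4) (qv ^+ 8) m ^+ r / qpoch (qv ^+ 8) (qv ^+ 8) m ^+ r)
         * qv ^ e * Efac qv xv ^+ r) (S ^+ r)].
Proof.
move=> n4 yE.
have nE : (n = 4 * m + 1)%N by rewrite /m; move: n4; clear; lia.
pose q0 : {fraction {poly rat}} := tofrac 'X.
have eq_q : evals (evalx y) qv q0.
  by have := evals_tofrac (evalx y) ('X%:P : bipoly); rewrite evalxC.
have eq_x : evals (evalx y) xv y.
  by have := evals_tofrac (evalx y) ('X : bipoly); rewrite evalxX.
have q0_neq0 : q0 != 0 by rewrite tofrac_eq0 polyX_eq0.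
have hq j : q0 ^+ j.+1 != 1.
  rewrite -tofracXn -tofrac1 tofrac_eq; apply/eqP => /polyP/(_ 0%N)/eqP.
  by rewrite coefXn coef1 eq_sym oner_eq0.
have wE : tofrac w = q0 ^+ (2 * n) by rewrite -tofracXn.
pose x1 := q0 ^- (2 * n).
have yE' : y = x1 \/ y = x1^-1 by rewrite /x1 invrK -wE; case: yE => ->; [right | left].
have y0 : y != 0 by case: yE' => ->; rewrite ?invr_neq0 ?expf_neq0.
have inj := expf_inj q0_neq0 hq.
have ne i j : i <> j -> q0 ^+ i != q0 ^+ j by move=> nij; apply/eqP => /inj.
(* Here $2n\equiv2$ modulo 8, so no factor of the denominators vanishes. *)
have gen j : (x1 * q0 ^+ (8 * j.+1) != 1) && (x1^-1 * q0 ^+ (8 * j.+1) != 1).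
  apply/andP; split; apply/eqP.
    move=> /(canRL (mulVKf (expf_neq0 (2 * n) q0_neq0))); rewrite mulr1.
    by move/inj; rewrite nE; clear; lia.
  by rewrite invrK -exprD -(expr0 q0) => /inj; clear; lia.
have ea k : evals (evalx y) (alphaq qv xv k) (alphaq q0 x1 k).
  have -> : alphaq q0 x1 k = alphaq q0 y k by case: yE' => ->; rewrite ?alphaq_inv.
  apply: (evals_alphaq eq_q eq_x k q0_neq0 y0 hq) => j; have /andP[g1 g2] := gen j.
    by case: yE' => ->; [exact: g1 | exact: g2].
  by rewrite mulrC; case: yE' => ->; [exact: g2 | rewrite invrK; exact: g1].
pose S := qint (q0 ^+ 2) n * (qpoch (q0 ^+ 4) (q0 ^+ 8) m / qpoch (q0 ^+ 8) (q0 ^+ 8) m)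
  * q0 ^- (2 * m) * Efac q0 x1.
have [] := sum_conv_alphaq m q0_neq0 hq; rewrite -nE -/x1 -/S => s2 s3 s4.
exists S => r e; rewrite -s2 -s3 -s4.
split=> [| | | eE].
- by apply: evals_sum => k; have [] := evals_conv k ea.
- by apply: evals_sum => k; have [] := evals_conv k ea.
- by apply: evals_sum => k; have [] := evals_conv k ea.
have nzD : qpoch (q0 ^+ 8) (q0 ^+ 8) m != 0.
  by apply: qpoch_neq0 => j _; rewrite -exprS -exprM mulnS (hq (7 + 8 * j)%N).
have X i := evalsX i eq_q.
have ev : evals (evalx y) (qpoch (qv ^+ 4) (qv ^+ 8) m / qpoch (qv ^+ 8) (qv ^+ 8) m)
    (qpoch (q0 ^+ 4) (q0 ^+ 8) m / qpoch (q0 ^+ 8) (q0 ^+ 8) m).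
  by apply: evals_div => //; apply: evals_qpoch.
have eE0 : evals (evalx y) (Efac qv xv) (Efac q0 x1).
  have -> : Efac q0 x1 = Efac q0 y by case: yE' => ->; rewrite ?Efac_inv.
  apply: (evals_Efac eq_q eq_x y0 (hq 0%N)).
  apply/eqP => h0; have /eqP := hq 3; apply.
  by rewrite (exprM q0 2 2) -[q0 ^+ 2](addKr 1) h0; ring.
have eZ : evals (evalx y) (qv ^ e) ((q0 ^- (2 * m)) ^+ r).
  rewrite eE; apply: evalsX.
  exact: evalsV (expf_neq0 (2 * m) q0_neq0) (X (2 * m)%N).
have := evals_target r (erefl _) (evals_qint n (X 2%N) (hq 1%N)) ev eZ eE0.
by rewrite -!exprMn.
Qed.

Theorem theorem4 (n : nat) (n_gt0 : (0 < n)%N)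
    (n_primes : forall p : nat, prime p -> (p %| n)%N -> (p %% 4 = 1)%N) :
  let q := qv in
  let x := xv in
  let M := qint (q ^+ 2) n * (1 - x * q ^+ (2 * n)) * (x - q ^+ (2 * n)) in
  let m := ((n - 1) %/ 4)%N in
  let N := qpoch (q ^+ 4) (q ^+ 8) m in
  let D := qpoch (q ^+ 8) (q ^+ 8) m in
  let E := Efac q x in
  [/\ ratcongr (\sum_(k < n) sq q x k)
        (qint (q ^+ 2) n ^+ 2 * (N ^+ 2 / D ^+ 2) * q ^ (1 - n%:Z) * E ^+ 2) M,
      ratcongr (\sum_(k < n) tq q x k)
        (qint (q ^+ 2) n ^+ 3 * (N ^+ 3 / D ^+ 3)
         * q ^ (3 * (1 - n%:Z) %/ 2)%Z * E ^+ 3) M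
    & ratcongr (\sum_(k < n) uq q x k)
        (qint (q ^+ 2) n ^+ 4 * (N ^+ 4 / D ^+ 4)
         * q ^ (2 * (1 - n%:Z)) * E ^+ 4) M].
Proof.
move=> q x M m N D E.
have n4 := modn4_primes n_gt0 n_primes.
have nE : (n = 4 * m + 1)%N by rewrite /m; move: n4; clear; lia.
pose w : {poly rat} := 'X^(2 * n).
have w0 : w != 0 by rewrite monic_neq0 ?monicXn.
have w1 : w ^+ 2 != 1.
  have n2 : (0 < 2 * n * 2)%N by rewrite !muln_gt0 n_gt0.
  rewrite -exprM; apply/eqP => /polyP /(_ 0%N) /eqP.
  by rewrite coefXn coef1 (ltn_eqF n2) eq_sym oner_eq0.
have qw : tofrac (w%:P : bipoly) = q ^+ (2 * n) by rewrite rmorphXn tofracXn.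
have ME : M = tofrac ((qgeom n)%:P * (1 - 'X * w%:P) * ('X - w%:P)).
  rewrite !tofracM !tofracB tofrac1 tofracM qw; congr (_ * _ * _).
  rewrite /qint -exprM.
  have q1 : 1 - q ^+ 2 != 0 by rewrite subr_eq0 eq_sym qvX_neq1.
  apply: (mulIf q1); rewrite divfK //.
  have := congr1 (fun c : {poly rat} => tofrac (c%:P : bipoly)) (qgeomE n).
  by rewrite polyCM !polyCB tofracM !tofracB polyC1 tofrac1 !polyC_exp !tofracXn.
(* At the roots of $[n]_{q^2}$ both sides specialize to 0; at the two values of $x$ it is enough
   that they agree. *)
have cong (U W : ratfun) :
    (forall z, root (map_poly ratr (qgeom n)) z -> evals (evalq z) U 0 /\ evals (evalq z) W 0) ->
    (forall y, y = tofrac w \/ y = (tofrac w)^-1 ->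
       exists v, evals (evalx y) U v /\ evals (evalx y) W v) ->
  ratcongr U W M.
  move=> hz hy; rewrite ME; apply: ratcongr_of_evals => //.
  - exact: qgeom_neq0.
  - by move=> p; apply: qgeom_dvd.
  - by move=> z /hz[eU eW]; rewrite -[0]subr0; apply: evalsB.
  - by have [|v [eU eW]] := hy (tofrac w); [left | rewrite -(subrr v); apply: evalsB].
  - by have [|v [eU eW]] := hy (tofrac w)^-1; [right | rewrite -(subrr v); apply: evalsB].
have qv0 : qv != 0 by rewrite tofrac_eq0 polyC_eq0 polyX_eq0.
have [e2 e3 e4] := exprz_target m qv0; rewrite -nE in e2 e3 e4.
split; apply: cong.
- by move=> z /(evals_at_root n_gt0 n_primes)[h2 h3 h4 hV]; split=> //; apply: hV.
- move=> y /(evals_at_power n4)[S hS]; exists (S ^+ 2).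
  by have [h2 _ _ hV] := hS 2%N (1 - n%:Z); split=> //; apply: hV.
- by move=> z /(evals_at_root n_gt0 n_primes)[h2 h3 h4 hV]; split=> //; apply: hV.
- move=> y /(evals_at_power n4)[S hS]; exists (S ^+ 3).
  by have [_ h3 _ hV] := hS 3%N (3 * (1 - n%:Z) %/ 2)%Z; split=> //; apply: hV.
- by move=> z /(evals_at_root n_gt0 n_primes)[h2 h3 h4 hV]; split=> //; apply: hV.
- move=> y /(evals_at_power n4)[S hS]; exists (S ^+ 4).
  by have [_ _ h4 hV] := hS 4%N (2 * (1 - n%:Z)); split=> //; apply: hV.
Qed.
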